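(* For every real $\epsilon>0$ there is a constant $M=M(\epsilon)$, depending only on $\epsilon$, such that the following holds. Let $G$ be a finite group with $d_2(G)\geq\epsilon$. Then $G$ has a subgroup $H$, nilpotent of class at most $4$, such that $[G:H]\leq M$ and $|\gamma_4(H)|\leq M$.
   Context: Commutators are $[x,y]=x^{-1}y^{-1}xy$ and $[x,y,z]=[[x,y],z]$. For a finite group $G$, $d_2(G)=|\{(x,y,z)\in G^3:[x,y,z]=1\}|/|G|^3$. $\gamma_i$ denotes the $i$-th term of the lower central series, with $\gamma_1(H)=H$ and $\gamma_{i+1}(H)=[\gamma_i(H),H]$. *)

(* Defs.v *)
From mathcomp Require Import all_boot all_order all_algebra all_fingroup all_solvable.
From mathcomp Require Import reals.

Set Implicit Arguments.
Unset Strict Implicit.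
Unset Printing Implicit Defensive.

Import GRing.Theory Num.Theory.

Local Open Scope ring_scope.

(* The library's commutators are those used here: [~ x, y] = x^-1 * y^-1 * x * y
   and [~ x, y, z] = [~ [~ x, y], z]. *)
Definition d2 (R : realType) (gT : finGroupType) (G : {group gT}) : R :=
  #|[set t : gT * gT * gT |
      [&& t.1.1 \in G, t.1.2 \in G, t.2 \in G &
          [~ t.1.1, t.1.2, t.2]%g == 1%g]]|%:R / #|G|%:R ^+ 3.

(* Main.v *)
Require Import Defs.
From mathcomp Require Import all_boot all_order all_algebra all_fingroup all_solvable.
From mathcomp Require Import reals.
From mathcomp Require Import zify.

(* Call a quantity bounded if it is at most a function of [eps].  A large value
   of d_2 makes the class of [x, y] bounded for many pairs (x, y).  As class sizes
   are submultiplicative, passing to a subgroup of bounded index we may assume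
   that every x has a subgroup S_x of bounded index with all classes of [x, s],
   s in S_x, bounded; then [x, y] always lies in a product c f with c in a bounded
   set C and f of bounded class.  For fixed c the commutators [c, v, z] lie in a
   bounded normal subgroup once v and z are restricted to a subgroup of bounded
   index; dividing these out for c in C, every commutator acts on the derived
   subgroup and modulo the centre like an element of bounded class.

   The last property bounds the second derived subgroup, which is divided out too.
   In a metabelian group [c, u, z, w] is multiplicative in each entry up to
   conjugation, symmetric in z and w and antisymmetric in c and u.  For fixed c it
   takes boundedly many values if z (or w) is restricted to a subgroup K_c of
   bounded index.  Comparing c with a generic c0 makes K_c independent of c, and
   then a maximality argument in c bounds the number of values altogether.

   The maximality argument, used throughout, goes back to Neumann and Wiegold:
   let f(v u) agree with f(v) f(u) up to conjugation and let u0 have the largest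
   number of values f(u0)(j).  If f(v) vanishes at the finitely many j realising
   them, then f(v u0) has the same values as f(u0), so all values of f(v) are
   conjugate to quotients of values of f(u0). *)

Set Implicit Arguments.
Unset Strict Implicit.
Unset Printing Implicit Defensive.

Local Open Scope group_scope.

(** * Indices and cardinalities *)

Lemma card_bigcup_le (I T : finType) (S : {set I}) (F : I -> {set T}) m :
  (forall i, i \in S -> #|F i| <= m) -> #|\bigcup_(i in S) F i| <= #|S| * m.
Proof.
move=> hF; apply: (@leq_trans (\sum_(i in S) #|F i|)).
  elim/big_rec2: _ => [|i n A _ hA]; first by rewrite cards0.
  by rewrite (leq_trans _ (leq_add (leqnn _) hA)) // cardsU leq_subr.
by rewrite -sum_nat_const leq_sum.
Qed.

(** One preimage for each value: the maximality arguments impose conditions only at the members of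
    [S], which are as few as the values. *)
Lemma exists_reps (T T' : finType) (f : T -> T') (A : {set T}) :
  exists2 S : {set T}, S \subset A /\ #|S| = #|f @: A| &
    forall x, x \in A -> exists2 y, y \in S & f y = f x.
Proof.
pose g y := [pick x in A | f x == y].
pose S := [set x in A | g (f x) == Some x].
have gP x : x \in A -> exists2 y, y \in S & f y = f x.
  move=> Ax; rewrite /S; case E: (g (f x)) => [y|]; last first.
    by move: E; rewrite /g; case: pickP => // /(_ x); rewrite Ax eqxx.
  have := E; rewrite {1}/g; case: pickP => // z /andP[Az /eqP fz] [zy].
  by exists y; rewrite -zy // inE Az fz E zy /=.
exists S => //; split; first by apply/subsetP=> x; rewrite inE => /andP[].
rewrite -(card_in_imset (f := f) (D := S)).
  apply: eq_card => y; apply/imsetP/imsetP => -[x].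
    by rewrite inE => /andP[Ax _] ->; exists x.
  by move=> Ax ->; have [z Sz fz] := gP _ Ax; exists z.
move=> x y; rewrite !inE => /andP[_ /eqP gx] /andP[_ /eqP gy] fxy.
by move: gx; rewrite fxy gy => -[].
Qed.

(** The generated group is the product of the cyclic groups of the elements of [Y], which centralise
    one another. *)
Lemma card_commuting_gen (gT : finGroupType) (Y : {set gT}) n :
    (forall x y, x \in Y -> y \in Y -> commute x y) ->
    (forall x, x \in Y -> #[x] <= n) -> #|<<Y>>| <= n ^ #|Y|.
Proof.
move=> cY oY; rewrite [#|Y|]cardE -[Y in <<Y>>]set_enum.
have: {subset enum Y <= Y} by move=> x; rewrite mem_enum.
elim: (enum Y) => [|x s IHs] sY.
  by rewrite set_nil gen0; apply: eq_leq; exact: (cards1 (1 : gT)).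
have Yx : x \in Y by apply: sY; rewrite inE eqxx.
have sY' : {subset s <= Y} by move=> y sy; apply: sY; rewrite inE sy orbT.
have cxs : <[x]> \subset 'C(<<[set:: s]>>).
  rewrite cent_gen cycle_subG; apply/centP=> y; rewrite inE => /sY' Yy.
  exact: cY.
have -> : <<[set:: x :: s]>> = <[x]> * <<[set:: s]>>.
  by rewrite -cent_joinEl // joing_idr joing_idl set_cons.
rewrite expnS; apply: leq_trans (leq_mul (oY _ Yx) (IHs sY')).
by rewrite orderE mul_cardG leq_pmulr // cardG_gt0.
Qed.

Section Index.
Variable gT : finGroupType.
Implicit Types (G H K U V : {group gT}) (x y z : gT).

(** Here and below [U] need not lie in [G]: [#|G : U|] counts the cosets of [U] meeting [G], so it
    equals the index of [G :&: U]. *)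
Lemma leq_index_setI G U V : #|G : U :&: V| <= #|G : U| * #|G : V|.
Proof.
have := mul_cardG (G :&: U) (G :&: V).
rewrite -setIIr => e.
have sub : #|(G :&: U) * (G :&: V)| <= #|G|.
  by rewrite subset_leq_card // mul_subG ?subsetIl.
have e1 := LagrangeI G U; have e2 := LagrangeI G V.
have e3 := LagrangeI G (U :&: V).
have p3 := cardG_gt0 (G :&: (U :&: V)).
rewrite -(leq_pmul2l p3) e3 -(leq_pmul2l (cardG_gt0 G)) -{1}e1 -{1}e2 mulnACA e.
by rewrite -mulnA; apply: leq_mul.
Qed.

Lemma leq_indexSl G H U : H \subset G -> #|H : U| <= #|G : U|.
Proof.
move=> sHG; have := mul_cardG H (G :&: U).
rewrite setIA (setIidPl sHG) => e.
have sub : #|H * (G :&: U)| <= #|G| by rewrite subset_leq_card // mul_subG ?subsetIl.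
have e1 := LagrangeI G U; have e2 := LagrangeI H U.
rewrite -(leq_pmul2l (cardG_gt0 (H :&: U))) e2 -(leq_pmul2l (cardG_gt0 (G :&: U))).
by rewrite mulnCA e1 mulnC e mulnC leq_mul.
Qed.

Lemma leq_indexSr G U V : U \subset V -> #|G : V| <= #|G : U|.
Proof.
move=> sUV; have e1 := LagrangeI G U; have e2 := LagrangeI G V.
have := subset_leq_card (setIS G sUV) => h.
by rewrite dvdn_leq ?indexgS.
Qed.

Lemma leq_index_trans G H U : H \subset G -> #|G : U| <= #|G : H| * #|H : U|.
Proof.
move=> sHG; rewrite -(indexgI H) Lagrange_index ?subsetIl //.
by rewrite leq_indexSr ?subsetIr.
Qed.

Lemma index_bigI (I : finType) (S : {set I}) (R : I -> gT -> Prop) G n b :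
    0 < b -> #|S| <= n ->
    (forall i, i \in S -> exists2 U : {group gT}, #|G : U| <= b &
       forall v, v \in U -> R i v) ->
  exists2 U : {group gT}, U \subset G /\ #|G : U| <= b ^ n &
    forall i v, i \in S -> v \in U -> R i v.
Proof.
move=> b0 hn hS.
suff: exists2 U : {group gT}, U \subset G /\ #|G : U| <= b ^ #|S| &
    forall i v, i \in S -> v \in U -> R i v.
  case=> U [sU iU] hU; exists U => //; split=> //.
  by apply: leq_trans iU _; rewrite leq_pexp2l.
have: {subset enum S <= S} by move=> x; rewrite mem_enum.
rewrite cardE; have : forall i, i \in S -> i \in enum S by move=> i; rewrite mem_enum.
move=> hS1 hS2.
suff [U h1 h2] : exists2 U : {group gT}, U \subset G /\ #|G : U| <= b ^ size (enum S) &
    forall i v, i \in enum S -> v \in U -> R i v.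
  by exists U => // i v /hS1; apply: h2.
elim: (enum S) hS2 => [|i s IHs] sS.
  by exists G; rewrite ?subxx ?indexgg.
have [|U [sU iU] hU] := IHs; first by move=> j sj; apply: sS; rewrite inE sj orbT.
have [V iV hV] := hS i (sS _ (mem_head _ _)).
exists (U :&: V)%G; first split.
- by rewrite subIset ?sU.
- by rewrite expnSr; apply: leq_trans (leq_index_setI _ _ _) (leq_mul iU iV).
- move=> j v; rewrite !inE => /orP[/eqP-> | sj] /andP[Uv Vv]; first exact: hV.
  exact: hU.
Qed.

(** The core is the intersection of the conjugates of [G :&: U]; there are at most [n] of them, each
    of index at most [n]. *)
Lemma index_core G U n : #|G : U| <= n ->
  exists2 N : {group gT}, N <| G /\ #|G : N| <= n ^ n & N \subset U.
Proof.
move=> iU; have n0 := leq_trans (indexg_gt0 G U) iU; pose S := (G :&: U) :^: G.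
have cS : #|S| <= n.
  rewrite card_conjugates (leq_trans _ iU) // -(indexgI G U).
  by rewrite leq_indexSr // subsetI subsetIl normG.
have [|V [sV iV] hV] := @index_bigI _ S (fun W v => v \in W) G n n n0 cS.
  move=> W /imsetP[x Gx ->]; exists ((G :&: U) :^ x)%G => //=.
  have -> : #|G : (G :&: U) :^ x| = #|G : U|.
    by rewrite -{1}(conjGid Gx) indexJg indexgI.
  exact: iU.
exists (gcore (G :&: U) G)%G; last by rewrite (subset_trans (gcore_sub _ _)) ?subsetIr.
split; first exact: gcore_normal (subsetIl _ _).
apply: leq_trans iV; apply: leq_indexSr; apply/bigcapsP=> x Gx.
by apply/subsetP=> v Vv; apply: hV => //; apply: imset_f.
Qed.

End Index.

(** * Sets generating a group in boundedly many steps *)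

Section Generation.
Variables (gT : finGroupType) (X : {set gT}).
Hypothesis X1 : 1 \in X.

Lemma subset_expgS n : X ^+ n \subset X ^+ n.+1.
Proof. by rewrite expgS -{1}[X ^+ n]mul1g mulSg // sub1set. Qed.

Lemma subset_expg m n : m <= n -> X ^+ m \subset X ^+ n.
Proof.
move=> /subnK <-; elim: (n - m) => // k IHk.
exact: subset_trans IHk (subset_expgS _).
Qed.

Lemma expg_sub_gen n : X ^+ n \subset <<X>>.
Proof.
elim: n => [|n IHn]; first by rewrite expg0 sub1G.
by rewrite expgS mul_subG ?subset_gen.
Qed.

Lemma mem_gen_expg x : x \in <<X>> -> exists n, x \in X ^+ n.
Proof.
have [n ->] := gen_expgs X; rewrite (setUidPr _) ?sub1set //.
by exists n.
Qed.

(** While the powers of [X] have not stabilised, three more factors add at least [#|X|] elements: if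
    [g] has length exactly 3i+3, the translate [g *: X] misses the power 3i+1, as [X] is symmetric,
    and both lie in the power 3i+4. After [a] rounds [#|G|] would be exceeded. *)
Lemma gen_eq_expg (G : {group gT}) a :
    (forall x, x \in X -> x^-1 \in X) -> X \subset G -> #|G| <= a * #|X| ->
  <<X>> = X ^+ (3 * a).
Proof.
move=> XV sXG cX; apply/eqP; rewrite eqEsubset expg_sub_gen andbT.
have X0 : 0 < #|X| by rewrite (cardD1 1) X1.
have stab j : j <= 3 * a -> X ^+ j.+1 \subset X ^+ j -> <<X>> \subset X ^+ (3 * a).
  move=> ja sj; apply/subsetP=> x /mem_gen_expg[n].
  apply/subsetP/(subset_trans _ (subset_expg ja)).
  elim: n => [|n IHn]; first exact: subset_expg.
  by rewrite expgS (subset_trans (mulgS X IHn)) // -expgS.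
have [j /andP[ja sj]|nstab] := pickP (fun j : 'I_(3 * a).+1 => (j <= 3 * a) && (X ^+ j.+1 \subset X ^+ j)).
  exact: stab sj.
have grow i : i <= a -> i.+1 * #|X| <= #|X ^+ (3 * i).+1|.
  elim: i => [|i IHi] ia; first by rewrite muln0 expg1 mul1n.
  have lt : (3 * i).+2 <= 3 * a by lia.
  have := nstab (Ordinal (lt : (3 * i).+2 < (3 * a).+1)); rewrite lt /= => /negbT.
  case/subsetPn=> g gin gout.
  have dis : [disjoint X ^+ (3 * i).+1 & g *: X].
    apply/pred0P=> y /=; apply: contraNF gout => /andP[y1 /lcosetP[x Xx ey]].
    have -> : g = y * x^-1 by rewrite ey mulgK.
    by rewrite expgSr mem_mulg ?XV.
  rewrite mulSn addnC -[X in _ + X](card_lcoset X g).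
  apply: leq_trans (leq_add (IHi (ltnW ia)) (leqnn _)) _.
  rewrite -cardsUI (disjoint_setI0 dis) cards0 addn0 subset_leq_card //.
  rewrite subUset subset_expg ?andTb; last by lia.
  rewrite (_ : (3 * i.+1).+1 = (3 * i).+3.+1); last by lia.
  by apply/subsetP=> _ /lcosetP[x Xx ->]; rewrite expgSr mem_mulg.
have := leq_trans (grow a (leqnn _)) (leq_trans (subset_leq_card (expg_sub_gen _)) (leq_trans (subset_leq_card _) cX)).
by rewrite gen_subG => /(_ sXG); rewrite leq_pmul2r ?ltnn.
Qed.

Lemma index_gen_le (G : {group gT}) a : X \subset G -> #|G| <= a * #|X| -> #|G : <<X>>| <= a.
Proof.
move=> sXG cX.
have sG : <<X>> \subset G by rewrite gen_subG.
rewrite -(leq_pmul2l (cardG_gt0 <<X>>)) Lagrange // (leq_trans cX) // mulnC leq_mul2r.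
by rewrite subset_leq_card ?subset_gen ?orbT.
Qed.

(** The set of conjugates of [p] by [X ^+ n] grows strictly from size 1 until it is stable, which
    happens for some [n <= k]. *)
Lemma class_gen_expg p k l : #|p ^: <<X>>| <= k -> l \in <<X>> ->
  exists2 z, z \in X ^+ k & p ^ z = p ^ l.
Proof.
move=> ck; pose O n := [set p ^ z | z in X ^+ n].
have sO m n : m <= n -> O m \subset O n by move=> mn; apply: imsetS; apply: subset_expg.
have sOc n : O n \subset p ^: <<X>>.
  apply/subsetP=> _ /imsetP[z zn ->]; apply: imset_f.
  exact: (subsetP (expg_sub_gen n)).
suff [j jk sj] : exists2 j, j <= k & O j.+1 \subset O j.
  move=> /mem_gen_expg[n ln]; have : p ^ l \in O k.
    apply: (subsetP (sO _ _ jk)); have : p ^ l \in O n by apply: imset_f.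
    elim: n {l ln} (p ^ l) => [|n IHn] y; first by apply/subsetP/sO.
    case/imsetP=> z; rewrite expgSr => /mulsgP[u v un Xv ->] ->.
    have /imsetP[w wj ew] : p ^ u \in O j by apply: IHn; apply: imset_f.
    apply: (subsetP sj); rewrite conjgM ew -conjgM; apply: imset_f.
    by rewrite expgSr mem_mulg.
  by case/imsetP=> z zk e; exists z.
have [j /andP[ja sj]|nstab] := pickP (fun j : 'I_k.+1 => (j <= k) && (O j.+1 \subset O j)).
  by exists j.
have grow i : i <= k.+1 -> i < #|O i|.
  elim: i => [|i IHi] ia.
    by rewrite card_gt0; apply/set0Pn; exists (p ^ 1); apply: imset_f; rewrite expg0 inE.
  apply: leq_ltn_trans (IHi (ltnW ia)) _; apply: proper_card; rewrite properE sO //=.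
  by have := nstab (Ordinal (ia : i < k.+1)); rewrite /= -ltnS ia /= => /negbT.
by have := leq_trans (grow k (leqnSn _)) (leq_trans (subset_leq_card (sOc _)) ck); rewrite ltnn.
Qed.

End Generation.

(** The elements with [2 * b * f x < m] contribute at most half of the known lower bound for the
    sum; the others contribute at most [m] each. *)
Lemma markov_card (T : finType) (A : {set T}) (f : T -> nat) m b :
    (forall x, x \in A -> f x <= m) -> #|A| * m <= b * \sum_(x in A) f x -> 0 < m ->
  #|A| <= (2 * b) * #|[set x in A | m <= (2 * b) * f x]|.
Proof.
move=> fm; rewrite (bigID (fun x => m <= (2 * b) * f x)) /= => h m0.
set B := [set x in A | _].
have h1 : \sum_(x in A | m <= 2 * b * f x) f x <= #|B| * m.
  rewrite -sum_nat_const (eq_bigl (fun x => x \in B)) => [|x]; last by rewrite inE.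
  by apply: leq_sum => x; rewrite inE => /andP[Ax _]; apply: fm.
have h2 : 2 * b * \sum_(x in A | ~~ (m <= 2 * b * f x)) f x <= #|A| * m.
  rewrite big_distrr /= -sum_nat_const big_mkcondr /=.
  by apply: leq_sum => x Ax; case: ifP => //; rewrite -ltnNge => /ltnW.
by rewrite -(leq_pmul2r m0); nia.
Qed.

(** * Submultiplicative functions of two variables *)

(** Three instances occur: the class size of [[~ c, w]], the number of values of [[~ c, u, z, w]]
    for fixed [c] and [w], and a relation encoded by a small and a large value. *)
Record submultiplicative (gT : finGroupType) (A B : {group gT})
    (mu : gT -> gT -> nat) : Prop := Submultiplicative {
  submulMl : forall c c' w, c \in A -> c' \in A -> w \in B ->
    mu (c * c') w <= mu c w * mu c' w;
  submulMr : forall c w w', c \in A -> w \in B -> w' \in B ->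
    mu c (w * w') <= mu c w * mu c w';
  submulVl : forall c w, c \in A -> w \in B -> mu c^-1 w <= mu c w;
  submulVr : forall c w, c \in A -> w \in B -> mu c w^-1 <= mu c w;
  submul1l : forall w, w \in B -> mu 1 w <= 1;
  submul1r : forall c, c \in A -> mu c 1 <= 1 }.

Lemma sum_card_exchange (T T' : finType) (A : {set T}) (B : {set T'}) (R : T -> T' -> bool) :
  \sum_(x in A) #|[set y in B | R x y]| = \sum_(y in B) #|[set x in A | R x y]|.
Proof.
have eq1 (U : finType) (C : {set U}) (P : pred U) :
    #|[set y in C | P y]| = \sum_(y in C) P y.
  rewrite -sum1_card [RHS]big_mkcond [LHS]big_mkcond; apply: eq_bigr => y _.
  by rewrite inE; case: (y \in C) => //=; case: (P y).
under eq_bigr do rewrite eq1; rewrite exchange_big /=.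
by apply: eq_bigr => y _; rewrite eq1.
Qed.

Lemma large_sections_sum (gT : finGroupType) (G : {group gT}) (R : rel gT) a :
    (forall c, c \in G -> exists2 U : {group gT}, #|G : U| <= a &
       forall w, w \in G -> w \in U -> R c w) ->
  #|G| ^ 2 <= a * \sum_(c in G) #|[set w in G | R c w]|.
Proof.
move=> hR; rewrite -mulnn -sum_nat_const big_distrr; apply: leq_sum => c /hR[U iU hU].
rewrite -(LagrangeI G U) mulnC; apply: leq_mul => //; apply: subset_leq_card.
by apply/subsetP=> w /setIP[Gw Uw]; rewrite inE Gw hU.
Qed.

(** Averaging and generation are used once in each variable. [W] has density at least 1/(2a) in [G],
    and so has [D w] for each [w] in [W]. Hence they generate subgroups of index at most [2 * a] in
    [l] steps, and submultiplicativity turns step counts into the bounds [M] and [M ^ l]. *)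
Lemma submultiplicative_core a : exists N, forall (gT : finGroupType) (G : {group gT}) mu,
    submultiplicative G G mu ->
    #|G| ^ 2 <= a * \sum_(c in G) #|[set w in G | mu c w <= a]| ->
  exists2 H : {group gT}, H \subset G /\ #|G : H| <= N &
    forall w, w \in H -> exists2 T : {group gT}, T \subset G /\ #|G : T| <= N &
      forall c, c \in T -> mu c w <= N.
Proof.
set l := (3 * (2 * a))%N; set M := (a ^ l)%N.
exists (2 * a + (2 * a) ^ l + M ^ l)%N => gT G mu sm h.
have G0 : 0 < #|G| := cardG_gt0 G.
have a0 : 0 < a.
  rewrite lt0n; apply: contraTneq h => ->.
  by rewrite mul0n -ltnNge expn_gt0 G0.
rewrite (sum_card_exchange _ _ (fun c w => mu c w <= a)) in h.
pose D w := [set c in G | mu c w <= a].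
pose W := [set w in G | #|G| <= (2 * a) * #|D w|].
have sDG w : D w \subset G by apply/subsetP=> c; rewrite inE => /andP[].
have sWG : W \subset G by apply/subsetP=> c; rewrite inE => /andP[].
have cW : #|G| <= (2 * a) * #|W|.
  by apply: markov_card => // x _; rewrite subset_leq_card.
have W1 : 1 \in W.
  rewrite inE group1; have -> : D 1 = G :> {set _}; last by rewrite leq_pmull // muln_gt0 a0.
  apply/setP=> c; rewrite inE andb_idr // => Gc.
  exact: leq_trans (submul1r sm Gc) a0.
have WV w : w \in W -> w^-1 \in W.
  rewrite !inE groupV => /andP[Gw cw]; rewrite Gw (leq_trans cw) //.
  rewrite leq_mul2l subset_leq_card ?orbT //; apply/subsetP=> c.
  by rewrite !inE => /andP[Gc mc]; rewrite Gc (leq_trans (submulVr sm _ _)).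
have eW := gen_eq_expg W1 WV sWG cW.
exists <<W>>%G; first split.
- by rewrite gen_subG.
- by rewrite -addnA (leq_trans (index_gen_le sWG cW)) ?leq_addr.
have good w : w \in W -> exists2 T : {group gT}, T \subset G /\ #|G : T| <= 2 * a &
    forall c, c \in T -> mu c w <= M.
  rewrite inE => /andP[Gw cw].
  have D1 : 1 \in D w by rewrite inE group1 (leq_trans (submul1l sm Gw)).
  have DV c : c \in D w -> c^-1 \in D w.
    by rewrite !inE groupV => /andP[Gc cc]; rewrite Gc (leq_trans (submulVl sm _ _)).
  have pw k c : c \in D w ^+ k -> mu c w <= a ^ k.
    elim: k c => [|k IHk] c; first by rewrite expg0 => /set1P->; rewrite (submul1l sm).
    rewrite expgS expnS => /mulsgP[x y Dx Dy ->].
    have Gy : y \in G.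
      by have := subsetP (expg_sub_gen (D w) k) y Dy; apply/subsetP; rewrite gen_subG.
    move: Dx; rewrite inE => /andP[Gx mx].
    by rewrite (leq_trans (submulMl sm _ _ _)) // leq_mul ?IHk.
  exists <<D w>>%G; first by rewrite gen_subG (index_gen_le (sDG w) cw).
  by move=> c /=; rewrite (gen_eq_expg D1 DV (sDG w) cw); apply: pw.
suff key k w : w \in W ^+ k -> w \in G /\ exists2 T : {group gT}, T \subset G /\ #|G : T| <= (2 * a) ^ k &
    forall c, c \in T -> mu c w <= M ^ k.
  move=> w; rewrite /= eW => /key[_ [T [sT iT] hT]]; exists T.
    by split=> //; rewrite (leq_trans iT) // -/l; lia.
  by move=> c /hT h1; rewrite (leq_trans h1) // -/l; lia.
elim: k w => [|k IHk] w.
  rewrite expg0 => /set1P->; split; first exact: group1.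
  exists G; first by rewrite subxx indexgg.
  by move=> c Gc; rewrite (submul1r sm).
rewrite expgS => /mulsgP[x y Wx /IHk[Gy [T [sT iT] hT]] ->].
have Gx := subsetP sWG x Wx; split; first exact: groupM.
have [U [sU iU] hU] := good x Wx.
exists (U :&: T)%G; first split.
- by rewrite subIset ?sU.
- by rewrite expnS (leq_trans (leq_index_setI _ _ _)) ?leq_mul.
- move=> c /setIP[Uc Tc]; rewrite expnS (leq_trans (submulMr sm _ _ _)) ?leq_mul ?hU ?hT //.
  exact: (subsetP sU).
Qed.

(** Exchanges the two entries: subgroups of good [z] for each [u] yield subgroups of good [u] for
    each [z] in some [H]. The relation becomes a submultiplicative function that is 1 where it
    holds. *)
Lemma relation_core a : exists N, forall (gT : finGroupType) (G : {group gT}) (R : rel gT),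
    (forall u v z, u \in G -> v \in G -> z \in G -> R u z -> R v z -> R (u * v) z) ->
    (forall u z t, u \in G -> z \in G -> t \in G -> R u z -> R u t -> R u (z * t)) ->
    (forall z, z \in G -> R 1 z) -> (forall u, u \in G -> R u 1) ->
    (forall u, u \in G -> exists2 U : {group gT}, #|G : U| <= a &
       forall z, z \in G -> z \in U -> R u z) ->
  exists2 H : {group gT}, H \subset G /\ #|G : H| <= N &
    forall z, z \in H -> exists2 T : {group gT}, T \subset G /\ #|G : T| <= N &
      forall u, u \in T -> R u z.
Proof.
have [N hN] := submultiplicative_core a.+1; exists N => gT G R RMl RMr R1l R1r hR.
(* The second value exceeds both the threshold and the bound of the previous
   lemma, so that a bounded [mu u z] forces [R u z]. *)
pose mu u z := if R u z then 1%N else maxn N.+1 a.+2.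
(* Inverses are powers in a finite group, so closure under products gives closure under inverses. *)
have RXl u z n : u \in G -> z \in G -> R u z -> R (u ^+ n) z.
  move=> Gu Gz Ruz; elim: n => [|n IHn]; first by rewrite expg0 R1l.
  by rewrite expgS RMl ?groupX.
have RXr u z n : u \in G -> z \in G -> R u z -> R u (z ^+ n).
  move=> Gu Gz Ruz; elim: n => [|n IHn]; first by rewrite expg0 R1r.
  by rewrite expgS RMr ?groupX.
have muR u z : (mu u z <= N) || (mu u z <= a.+1) -> R u z.
  by rewrite /mu; case: (R u z); rewrite // !geq_max !ltnn andbF.
have K0 : 0 < maxn N.+1 a.+2 by rewrite leq_max.
have mu0 u z : 0 < mu u z by rewrite /mu; case: ifP.
have muK u z : mu u z <= maxn N.+1 a.+2 by rewrite /mu; case: ifP.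
have muF u z : R u z = false -> mu u z = maxn N.+1 a.+2 by rewrite /mu => ->.
have [|| H sH hH] := hN gT G mu.
- split.
  + move=> u v z Gu Gv Gz; case Ru: (R u z); last by rewrite (leq_trans (muK _ _)) // -(muF _ _ Ru) leq_pmulr.
    case Rv: (R v z); last by rewrite (leq_trans (muK _ _)) // -(muF _ _ Rv) leq_pmull.
    by rewrite {1}/mu RMl ?muln_gt0 ?mu0.
  + move=> u z t Gu Gz Gt; case Ru: (R u z); last by rewrite (leq_trans (muK _ _)) // -(muF _ _ Ru) leq_pmulr.
    case Rv: (R u t); last by rewrite (leq_trans (muK _ _)) // -(muF _ _ Rv) leq_pmull.
    by rewrite {1}/mu RMr ?muln_gt0 ?mu0.
  + move=> u z Gu Gz; case Ru: (R u z); last by rewrite (leq_trans (muK _ _)) // -(muF _ _ Ru).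
    by rewrite {1}/mu invg_expg RXl.
  + move=> u z Gu Gz; case Ru: (R u z); last by rewrite (leq_trans (muK _ _)) // -(muF _ _ Ru).
    by rewrite {1}/mu invg_expg RXr.
  + by move=> z Gz; rewrite /mu R1l.
  + by move=> u Gu; rewrite /mu R1r.
- apply: large_sections_sum => u /hR[U iU hU]; exists U; first exact: leqW.
  by move=> z Gz Uz; rewrite /mu hU.
- exists H => // z /hH[T sT hT]; exists T => // u /hT h.
  by apply: muR; rewrite h.
Qed.

(* A set [W] is separated for [c] at scale [M] if [mu c (w * w'^-1) > M] for
   distinct [w, w'] in [W]; then [#|W| <= n] as soon as [M >= n].  Take a scale [M]
   at which the largest size is the same as at scale [M * n ^ 2], and [c0], [W]
   realising it at the latter: multiplying [c0] by [c] keeps [W] separated at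
   scale [M], hence maximal. *)
Lemma generic_point n : exists N, forall (gT : finGroupType) (A B : {group gT}) mu,
    submultiplicative A B mu ->
    (forall c, c \in A -> exists2 S : {group gT}, #|B : S| <= n &
       forall w, w \in B -> w \in S -> mu c w <= n) ->
    (forall w, w \in B -> exists2 T : {group gT}, #|A : T| <= n &
       forall c, c \in A -> c \in T -> mu c w <= n) ->
  exists c0 (W : {set gT}) (V : {group gT}),
    [/\ c0 \in A, W \subset B /\ #|W| <= n, V \subset A /\ #|A : V| <= N,
        forall c w, c \in V -> w \in W -> mu c w <= n &
        forall c w, c \in V -> w \in B ->
          exists2 w', w' \in W & mu (c * c0) (w * w'^-1) <= N].
Proof.
(* [n ^ n] bounds the index of [V]; the scale starts at [n] and is multiplied by [n ^ 2] at most [n]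
   times. *)
exists (n ^ n + n * (n ^ 2) ^ n)%N => gT A B mu sm hA hB.
have n0 : 0 < n by have [S iS _] := hA 1 (group1 A); exact: leq_trans iS.
pose sep c M (W : {set gT}) :=
  [forall w in W, forall w' in W, (w != w') ==> (M < mu c (w * w'^-1))].
have sepP c M (W : {set gT}) w w' : sep c M W -> w \in W -> w' \in W -> w != w' ->
    M < mu c (w * w'^-1).
  move=> /forall_inP h Ww Ww' nw; have /forall_inP := h w Ww.
  by move/(_ w' Ww'); rewrite nw.
have sepn c (W : {set gT}) : c \in A -> W \subset B -> sep c n W -> #|W| <= n.
  move=> Ac sW sepW; have [S iS hS] := hA c Ac.
  rewrite -(card_in_imset (f := fun w => S :* w)).
    apply: leq_trans iS; apply: subset_leq_card; apply/subsetP=> _ /imsetP[w Ww ->].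
    by apply/rcosetsP; exists w; rewrite ?(subsetP sW).
  move=> w w' Ww Ww' /= e; apply/eqP; apply: contraT => nw.
  have := sepP _ _ _ _ _ sepW Ww Ww' nw.
  rewrite ltnNge hS //; first by rewrite groupM ?groupV ?(subsetP sW).
  by rewrite -mem_rcoset -e rcoset_refl.
(* [r] bounds the sets separated at scale [M]. Either size [r] is attained at scale [M * n ^ 2], or
   the search continues at that scale with a smaller [r]. *)
suff rec r M : 0 < M -> (forall c (W : {set gT}), c \in A -> W \subset B -> sep c M W -> #|W| <= r) -> r <= n ->
   exists c0 (W : {set gT}) (V : {group gT}),
    [/\ c0 \in A, W \subset B /\ #|W| <= n, V \subset A /\ #|A : V| <= n ^ n,
        forall c w, c \in V -> w \in W -> mu c w <= n &
        forall c w, c \in V -> w \in B ->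
          exists2 w', w' \in W & mu (c * c0) (w * w'^-1) <= M * (n ^ 2) ^ r].
  have [c0 [W [V [h1 h2 [h3 h3'] h4 h5]]]] := rec n n n0 sepn (leqnn n).
  exists c0, W, V; split=> //; first by rewrite (leq_trans h3') ?leq_addr.
  move=> c w Vc Bw; have [w' Ww' h6] := h5 c w Vc Bw.
  by exists w' => //; apply: leq_trans h6 _; rewrite leq_addl.
elim: r M => [|r IHr] M M0 hM rn.
  have := hM 1 [set 1] (group1 A); rewrite sub1set group1 cards1 => h.
  suff : 1 <= 0 by []; apply: h => //.
  by apply/forall_inP=> w /set1P->; apply/forall_inP=> w' /set1P->; rewrite eqxx.
have MM : M <= M * n ^ 2 by rewrite leq_pmulr // expn_gt0 n0.
pose found := [exists c0 in A, exists W : {set gT}, [&& W \subset B, sep c0 (M * n ^ 2)%N W & #|W| == r.+1]].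
have [/exists_inP[c0 Ac0 /existsP[W /and3P[sW sepW /eqP cW]]]|nf] := boolP found; last first.
  have [||c0 [W [V [h1 h2 h3 h4 h5]]]] := IHr (M * n ^ 2)%N _ _ (ltnW rn).
  - exact: leq_trans MM.
  - move=> c W Ac sW sepW.
    have sepW' : sep c M W.
      apply/forall_inP=> w Ww; apply/forall_inP=> w' Ww'; apply/implyP=> nw.
      exact: leq_ltn_trans MM (sepP _ _ _ _ _ sepW Ww Ww' nw).
    have := hM c W Ac sW sepW'; rewrite leq_eqVlt => /orP[cW|//].
    case/negP: nf; apply/exists_inP; exists c => //; apply/existsP; exists W.
    by rewrite sW sepW.
  exists c0, W, V; split=> //; by rewrite expnS mulnA.
have [||V [sV iV] hV] := @index_bigI _ _ W (fun w c => c \in A -> mu c w <= n) A n n n0.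
- by rewrite cW.
- move=> w Ww; have [|T iT hT] := hB w; first exact: (subsetP sW).
  by exists T => // c Tc Ac; apply: hT.
exists c0, W, V; split=> //; first by rewrite sW cW.
  by move=> c w Vc Ww; apply: hV => //; apply: (subsetP sV).
move=> c w Vc Bw; have Ac := subsetP sV c Vc.
have muV x v : x \in A -> v \in B -> mu x v <= mu x v^-1.
  by move=> Ax Bv; rewrite -{1}[v]invgK (submulVr sm) ?groupV.
(* For [c] in [V] the value of [mu c^-1] at a quotient of elements of [W] is at most [n ^ 2], so
   replacing [c0] by [c * c0] costs at most this factor of separation. *)
have sepc w1 w2 : w1 \in W -> w2 \in W -> w1 != w2 -> M < mu (c * c0) (w1 * w2^-1).
  move=> Ww1 Ww2 nw; have h := sepP _ _ _ _ _ sepW Ww1 Ww2 nw.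
  have B1 := subsetP sW _ Ww1; have B2 := subsetP sW _ Ww2.
  have B12 : w1 * w2^-1 \in B by rewrite groupM ?groupV.
  have h1 : mu c^-1 (w1 * w2^-1) <= n ^ 2.
    apply: leq_trans (submulVl sm Ac B12) _.
    apply: leq_trans (submulMr sm Ac B1 _) _; first by rewrite groupV.
    rewrite -mulnn leq_mul //; first exact: hV.
    by apply: leq_trans (submulVr sm Ac B2) _; apply: hV.
  have h2 : mu c0 (w1 * w2^-1) <= mu c^-1 (w1 * w2^-1) * mu (c * c0) (w1 * w2^-1).
    rewrite -{1}[c0](mulKg c); apply: (submulMl sm) => //; first by rewrite groupV.
    exact: groupM.
  rewrite ltnNge; apply/negP => h3; move: h; rewrite ltnNge => /negP; apply.
  by apply: leq_trans h2 _; rewrite mulnC leq_mul.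
have [/exists_inP[w' Ww' h]|/exists_inPn nw] := boolP [exists w' in W, mu (c * c0) (w * w'^-1) <= M].
  exists w' => //; apply: leq_trans h _; rewrite leq_pmulr // expn_gt0 expn_gt0 n0 //.
have wW : w \notin W.
  apply: contraL isT => Ww; have := nw w Ww; rewrite mulgV.
  by rewrite (leq_trans (submul1r sm _)) ?groupM.
(* Otherwise [w |: W] is separated for [c * c0] at scale [M], with one element more than [hM]
   allows. *)
have := hM (c * c0) (w |: W) (groupM Ac Ac0).
rewrite cardsU1 wW cW ltnn subUset sub1set Bw sW => /(_ isT) h.
suff: false by []; apply: h.
apply/forall_inP=> w1 /setU1P h1; apply/forall_inP=> w2 /setU1P h2; apply/implyP=> n12.
case: h1 h2 n12 => [-> |W1] [-> |W2]; rewrite ?eqxx // => n12.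
- by rewrite ltnNge nw.
- rewrite ltnNge; apply/negP => h; case/negP: (nw w1 W1).
  apply: leq_trans (muV _ _ (groupM Ac Ac0) _) _.
    by rewrite groupM ?groupV //; apply: (subsetP sW).
  by rewrite invMg invgK.
- exact: sepc.
Qed.

(** * Conjugacy classes and commutators *)

Lemma commVgJ (gT : finGroupType) (x y : gT) : [~ x^-1, y] = [~ x, y]^-1 ^ x^-1.
Proof.
by apply: (mulgI ([~ x, y] ^ x^-1)); rewrite -commMgJ -[RHS]conjMg !mulgV comm1g conj1g.
Qed.

Section Classes.
Variable gT : finGroupType.
Implicit Types (A B Y : {set gT}) (G L M : {group gT}) (g h x y : gT).

Lemma card_mulg_le A B : #|A * B| <= #|A| * #|B|.
Proof.
rewrite -cardsX (_ : A * B = (fun p => p.1 * p.2) @: setX A B).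
  exact: leq_imset_card.
apply/setP=> x; apply/mulsgP/imsetP => [[a b Aa Bb ->]|[[a b] /=]].
  by exists (a, b); rewrite ?inE ?Aa.
by rewrite inE => /andP[Aa Bb] ->; exists a b.
Qed.

Lemma card_classM L g h : #|(g * h) ^: L| <= #|g ^: L| * #|h ^: L|.
Proof.
apply: leq_trans (card_mulg_le _ _); apply: subset_leq_card.
by apply/subsetP=> _ /imsetP[x Lx ->]; rewrite conjMg mem_mulg ?imset_f.
Qed.

Lemma card_classV L g : #|g^-1 ^: L| = #|g ^: L|.
Proof. by rewrite classVg card_invg. Qed.

Lemma card_classJ L g x : x \in 'N(L) -> #|(g ^ x) ^: L| = #|g ^: L|.
Proof.
move=> nLx; rewrite -(cardJg (g ^: L) x); apply: eq_card => y.
apply/imsetP/imsetP => [[l Ll ->]|[_ /imsetP[l Ll ->] ->]].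
  exists (g ^ (l ^ x^-1)); first by rewrite imset_f // memJ_norm ?groupV.
  by rewrite -!conjgM; congr (g ^ _); rewrite conjgE invgK !mulgA mulgKV.
by exists (l ^ x); rewrite ?memJ_norm // -!conjgM -conjgC.
Qed.

Lemma card_class_subl G L g : L \subset G -> #|g ^: L| <= #|g ^: G|.
Proof. by move=> sLG; rewrite subset_leq_card ?imsetS. Qed.

Lemma card_class_support_le A L k : (forall a, a \in A -> #|a ^: L| <= k) ->
  #|class_support A L| <= #|A| * k.
Proof. by rewrite class_supportEl; apply: card_bigcup_le. Qed.

Lemma card_class_commg L g l k : l \in L -> #|g ^: L| <= k -> #|[~ g, l] ^: L| <= k ^ 2.
Proof.
move=> Ll ck; rewrite commgEl (leq_trans (card_classM _ _ _)) //.
by rewrite card_classV card_classJ ?(subsetP (normG L)) // -mulnn leq_mul.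
Qed.

(* If [q] commutes with enough conjugators of [p], left multiplication by [q]
   embeds the class of [p] into that of [q * p]; the two then coincide. *)
Lemma commg_class_maximal L (Z : {set gT}) p q :
    (forall l, l \in L -> exists2 z, z \in Z & p ^ z = p ^ l) ->
    (forall z, z \in Z -> z \in L /\ commute q z) ->
    #|(q * p) ^: L| <= #|p ^: L| ->
  forall l, l \in L -> [~ q, l] \in (p ^: L) * (p ^: L)^-1.
Proof.
move=> hZ cZ cqp l Ll.
have sq : q *: (p ^: L) \subset (q * p) ^: L.
  apply/subsetP=> _ /lcosetP[_ /imsetP[m Lm ->] ->].
  have [z Zz <-] := hZ m Lm; have [Lz cqz] := cZ z Zz.
  have -> : q * p ^ z = (q * p) ^ z by rewrite conjMg [q ^ z]conjgE cqz mulKg.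
  exact: imset_f.
have e : q *: (p ^: L) = (q * p) ^: L by apply/eqP; rewrite eqEcard sq card_lcoset.
have : (q * p) ^ l \in q *: (p ^: L) by rewrite e imset_f.
rewrite mem_lcoset conjMg => h.
have -> : [~ q, l] = q^-1 * (q ^ l * p ^ l) * (p ^ l)^-1 by rewrite mulgA mulgK commgEl.
by rewrite mem_mulg // inE invgK imset_f.
Qed.

Lemma exists_coset_reps G (U : {group gT}) : exists2 S : {set gT},
  S \subset G /\ #|S| = #|G : U| & forall x, x \in G -> exists2 y, y \in S & x * y^-1 \in U.
Proof.
have [S [sS cS] hS] := exists_reps (fun x => U :* x) G; exists S.
  split=> //; rewrite cS; apply: eq_card => W.
  by apply/imsetP/rcosetsP => -[x]; exists x.
by move=> x /hS[y Sy e]; exists y => //; rewrite -mem_rcoset e rcoset_refl.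
Qed.

(* For fixed [a] the map [b |-> [~ a, b]] is a homomorphism on ['C_G(Y)], so the
   order of each [~ a, b] is bounded, and these elements commute with each other. *)
Lemma commutators_bounded G Y n :
    Y \subset G -> G \subset 'N(Y) -> #|Y| <= n ->
  [/\ 'C_G(Y) <| G, #|G : 'C_G(Y)| <= n ^ n &
    forall A (B : {group gT}), A \subset G -> B \subset 'C_G(Y) ->
      (forall a b, a \in A -> b \in B -> [~ a, b] \in Y) -> #|[~: A, B]| <= n ^ n].
Proof.
move=> sYG nYG cY; have nM : 'C_G(Y) <| G by rewrite /normal subsetIl normsI ?normG ?norms_cent.
split=> //.
  have [Y0|n0] := posnP n.
    have -> : Y = set0 by apply/eqP; rewrite -cards_eq0 -leqn0 -Y0.
    rewrite (_ : 'C_G(set0) = G) ?indexgg ?Y0 //.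
    by apply/setIidPl; rewrite centsC sub0set.
  have [|U [sU iU] hU] := @index_bigI _ _ Y (fun y v => v \in 'C[y]) G n n n0 cY.
    move=> y Yy; exists 'C_G[y]%G; last by move=> v /setIP[].
    rewrite index_cent1 (leq_trans _ cY) // subset_leq_card //.
    by apply/subsetP=> _ /imsetP[g Gg ->]; rewrite memJ_norm ?(subsetP nYG).
  apply: leq_trans iU; apply: leq_indexSr; rewrite subsetI sU.
  apply/subsetP=> v Uv; apply/centP=> y Yy; have := hU y v Yy Uv.
  by move/cent1P.
move=> A B sAG sBM hAB.
have sE a b : a \in A -> b \in B -> [~ a, b] \in 'C_G(Y).
  move=> Aa Bb; have Ga := subsetP sAG a Aa; have Mb := subsetP sBM b Bb.
  by rewrite commgEr groupM // memJ_norm ?groupV // (subsetP (normal_norm nM)) .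
have sEY : commg_set A B \subset Y.
  by apply/subsetP=> _ /imset2P[a b Aa Bb ->]; apply: hAB.
rewrite /commutator.
apply: leq_trans (card_commuting_gen (n := n) _ _) _.
- move=> _ y /imset2P[a b Aa Bb ->] Ey.
  by have /setIP[_ /centP h] := sE a b Aa Bb; apply: h; apply: (subsetP sEY).
- move=> _ /imset2P[a b Aa Bb ->].
  apply: leq_trans cY; rewrite orderE; apply: subset_leq_card.
  apply/subsetP=> _ /cycleP[i ->].
  suff <- : [~ a, b ^+ i] = [~ a, b] ^+ i by rewrite hAB ?groupX.
  elim: i => [|i IHi]; first by rewrite !expg0 commg1.
  rewrite expgS commgMJ IHi expgSr; congr (_ * _); apply/conjg_fixP/commgP.
  have /setIP[_ /centP cb] : b ^+ i \in 'C_G(Y) by rewrite groupX // (subsetP sBM).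
  by apply: commute_sym; apply: cb; apply: hAB.
case: n cY => [|n] cY; last by rewrite leq_pexp2l // (leq_trans (subset_leq_card sEY)).
by have := subset_leq_card sEY; move: cY; rewrite leqn0 => /eqP->; rewrite leqn0 => /eqP->.
Qed.

End Classes.

(** Each [f _ j] is a crossed homomorphism. Maximality of [u0] bounds the values of [f v] for [v] in
    a subgroup of bounded index; a general [u] is such a [v] times one of boundedly many coset
    representatives [t]. *)
Lemma crossed_hom_values_bounded n b : exists N,
  forall (gT : finGroupType) (J : finType) (G : {group gT}) (P : {set J}) (f : gT -> J -> gT),
    (forall u v j, u \in G -> v \in G -> j \in P -> f (v * u) j = f v j ^ u * f u j) ->
    (forall u, u \in G -> #|f u @: P| <= n) ->
    (forall j, j \in P -> exists2 U : {group gT}, #|G : U| <= b &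
       forall v, v \in G -> v \in U -> f v j = 1) ->
  #|\bigcup_(u in G) f u @: P| <= N.
Proof.
(* [b.+1] is positive even if [P] is empty and [b] is 0. Two factors [n] come from the quotients of
   values of [f u0], one from [f t]. *)
exists (b.+1 ^ n * (n * n * n))%N => gT J G P f fM cf hU.
pose F u := #|f u @: P|.
have [u0 Gu0 max0] := arg_maxnP F (group1 G : (fun x => x \in G) 1).
have [R [sR cR] hR] := exists_reps (f u0) P.
have cR' : #|R| <= n by rewrite cR cf.
have [|U [sU iU] hU'] := @index_bigI _ _ R (fun j v => v \in G -> f v j = 1) G n b.+1 isT cR'.
  move=> j Rj; have [|U iU hU'] := hU j; first exact: (subsetP sR).
  by exists U; [exact: leqW | move=> v Uv Gv; apply: hU'].
have key v j : v \in U -> j \in P -> f v j ^ u0 \in (f u0 @: P) * (f u0 @: P)^-1.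
  move=> Uv Pj; have Gv := subsetP sU v Uv.
  have sV : f u0 @: P \subset f (v * u0) @: P.
    apply/subsetP=> _ /imsetP[i Pi ->]; have [i' Ri' <-] := hR i Pi.
    have Pi' := subsetP sR i' Ri'; apply/imsetP; exists i' => //.
    by rewrite fM // (hU' i' v) // conj1g mul1g.
  have eV : f u0 @: P = f (v * u0) @: P.
    by apply/eqP; rewrite eqEcard sV; apply: max0; apply: groupM.
  have -> : f v j ^ u0 = f (v * u0) j * (f u0 j)^-1 by rewrite fM // mulgK.
  by rewrite mem_mulg ?inE ?invgK ?imset_f // eV imset_f.
have [S [sS cS] hS] := exists_coset_reps G U.
pose D t := ((f u0 @: P) * (f u0 @: P)^-1) :^ (u0^-1 * t) * (f t @: P).
apply: (@leq_trans #|\bigcup_(t in S) D t|).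
  apply: subset_leq_card; apply/bigcupsP=> u Gu; apply/subsetP=> _ /imsetP[j Pj ->].
  have [t St Ut] := hS u Gu; apply/bigcupP; exists t => //.
  have Gt := subsetP sS t St.
  rewrite -[u](mulgKV t) fM //; last exact: (subsetP sU).
  apply: mem_mulg; last exact: imset_f.
  by rewrite mem_conjg invMg invgK conjgM conjgK key.
apply: leq_trans (card_bigcup_le (m := (n * n * n)%N) _) _.
  move=> t St; apply: leq_trans (card_mulg_le _ _) _.
  rewrite leq_mul ?cf ?(subsetP sS) // cardJg (leq_trans (card_mulg_le _ _)) //.
  by rewrite card_invg leq_mul ?cf.
by rewrite leq_mul // cS.
Qed.

(** * Commutators with a fixed left entry *)

Lemma norms_commg (gT : finGroupType) (A B C : {set gT}) :
  A \subset 'N(B) -> A \subset 'N(C) -> A \subset 'N([~: B, C]).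
Proof.
move=> nB nC; apply: norms_gen; apply/subsetP=> a Aa.
rewrite inE; apply/subsetP=> _ /imsetP[_ /imset2P[b c Bb Cc ->] ->].
by rewrite conjRg; apply: imset2_f; rewrite memJ_norm ?(subsetP nB) ?(subsetP nC).
Qed.

(** By [[~ x * y, b] = [~ x, b] ^ y * [~ y, b]], the [x] normalising [E] with all [[~ x, b]] in [E]
    form a group, so it is enough to test generators. *)
Lemma gen_commg_sub (gT : finGroupType) (A B : {set gT}) (E : {group gT}) :
    A \subset 'N(E) -> (forall a b, a \in A -> b \in B -> [~ a, b] \in E) ->
  [~: <<A>>, B] \subset E.
Proof.
move=> nEA hAB; pose K := [set x in 'N(E) | [forall b in B, [~ x, b] \in E]].
have gK : group_set K.
  apply/group_setP; split.
    by apply/setIdP; split=> //; apply/forall_inP=> b _; rewrite comm1g.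
  move=> x y /setIdP[Nx /forall_inP hx] /setIdP[Ny /forall_inP hy].
  apply/setIdP; split; first exact: groupM.
  apply/forall_inP=> b Bb; rewrite commMgJ groupM ?hy //.
  by rewrite memJ_norm ?hx.
have sAK : <<A>> \subset Group gK.
  rewrite gen_subG; apply/subsetP=> a Aa; apply/setIdP; split; first exact: (subsetP nEA).
  by apply/forall_inP=> b Bb; apply: hAB.
rewrite gen_subG; apply/subsetP=> _ /imset2P[x b Ax Bb ->].
by have /setIdP[_ /forall_inP] := subsetP sAK x Ax; apply.
Qed.

Section NearlyCentral.
Variable gT : finGroupType.
Implicit Types (G L : {group gT}).

(** The index is taken in [G], although only elements of [L] commute with [z]: the subgroups can
    then be made normal in [G] and their cosets used for elements outside [L]. *)
Definition nearly_central b G L (z : gT) :=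
  [exists U : {group gT}, (#|G : U| <= b) && (L :&: U \subset 'C[z])].

Lemma nearly_central_expg k m G L (X : {set gT}) z :
    (forall x, x \in X -> nearly_central k G L x) -> z \in X ^+ m ->
  nearly_central (k ^ m) G L z.
Proof.
move=> hX; elim: m z => [|m IHm] z.
  rewrite expg0 => /set1P->; apply/existsP; exists G.
  by rewrite indexgg expn0 cent11T subsetT.
rewrite expgS => /mulsgP[x y /hX/existsP[U /andP[iU cU]] /IHm/existsP[V /andP[iV cV]] ->].
apply/existsP; exists (U :&: V)%G; rewrite expnS (leq_trans (leq_index_setI _ _ _)) ?leq_mul //=.
apply/subsetP=> v /setIP[Lv /setIP[Uv Vv]]; apply/cent1P/commuteM.
  by apply/cent1P/(subsetP cU); rewrite inE Lv.
by apply/cent1P/(subsetP cV); rewrite inE Lv.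
Qed.

(** Every conjugate of [p] is reached by a product of [k] factors from [X], and each factor costs an
    index [k]. *)
Lemma class_nearly_central k G L (X : {set gT}) p l :
    1 \in X -> <<X>> = L -> (forall x, x \in X -> nearly_central k G L x) ->
    #|p ^: L| <= k -> l \in L ->
  exists2 z, (z \in L) && nearly_central (k ^ k) G L z & p ^ z = p ^ l.
Proof.
move=> X1 <- hX cp Ll; have [z Xz e] := class_gen_expg X1 cp Ll; exists z => //.
by rewrite (subsetP (expg_sub_gen X k)) //= (nearly_central_expg hX Xz).
Qed.

Lemma nearly_central_common b n G L (Z : {set gT}) :
    0 < b -> #|Z| <= n -> (forall z, z \in Z -> nearly_central b G L z) ->
  exists2 U : {group gT}, U <| G /\ #|G : U| <= (b ^ n) ^ (b ^ n) &
    forall z v, z \in Z -> v \in U -> v \in L -> commute v z.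
Proof.
move=> b0 cZ hZ.
have [|U [sU iU] hU] := @index_bigI _ _ Z (fun z v => v \in L -> commute v z) G n b b0 cZ.
  move=> z /hZ/existsP[U /andP[iU cU]]; exists U => // v Uv Lv.
  by apply/cent1P/(subsetP cU); rewrite inE Lv.
have [V hV sVU] := index_core iU; exists V => // z v Zz Vv.
by apply: hU => //; apply: (subsetP sVU).
Qed.

End NearlyCentral.

(* Choose [u] in [S] such that the class of [~ c, u] is largest. Elements of [S]
   moving [c] by the same coset of the common centralizer [U] are compared
   through the identity c^-s c^t . [~ c, u]^t = [~ c, u t s^-1]^s. *)
Lemma commutators_fixed_left_bounded k : exists N,
  forall (gT : finGroupType) (G S L : {group gT}) (X : {set gT}) c,
    S \subset G -> L <| G -> 1 \in X -> <<X>> = L -> c \in G ->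
    (forall x, x \in X -> nearly_central k G L x) ->
    (forall s, s \in S -> [~ c, s] \in L /\ #|[~ c, s] ^: L| <= k) ->
  #|[set [~ c, s, z] | s in S, z in L]| <= N.
Proof.
pose b := (k ^ k)%N; pose B := ((b ^ k) ^ (b ^ k))%N.
exists (B * ((k * (k * k)) * (k * k * (k * k))))%N => gT G S L X c sSG nLG X1 eL Gc hX hS.
have k0 : 0 < k.
  have [_] := hS 1 (group1 S); apply: leq_trans.
  by rewrite card_gt0; apply/set0Pn; exists [~ c, 1]; apply: class_refl.
have sLG := normal_sub nLG; have nLS x : x \in G -> x \in 'N(L) by apply/subsetP/normal_norm.
have [u Su maxu] := arg_maxnP (fun s => #|[~ c, s] ^: L|) (group1 S : (fun x => x \in S) 1).
set p := [~ c, u] in maxu *.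
have [_ cp] := hS u Su.
pose good := [set z in L | nearly_central b G L z].
have [Z [sZ cZ] hZ] := exists_reps (conjg p) good.
have cZk : #|Z| <= k.
  rewrite cZ; apply: leq_trans cp; apply: subset_leq_card; apply/subsetP=> _ /imsetP[z zg ->].
  by apply: imset_f; move: zg; rewrite inE => /andP[].
have b0 : 0 < b by rewrite expn_gt0 k0.
have [|U [nU iU] cU] := nearly_central_common b0 cZk (G := G) (L := L).
  by move=> z /(subsetP sZ); rewrite inE => /andP[].
have pZ l : l \in L -> exists2 z, z \in Z & p ^ z = p ^ l.
  move=> Ll; have [z zg <-] := class_nearly_central X1 eL hX cp Ll.
  by apply: hZ; rewrite inE.
have ZL z : z \in Z -> z \in L by move/(subsetP sZ); rewrite inE => /andP[].
have [T [sT cT] hT] := exists_reps (fun s => U :* (c ^ s)) S.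
have cTB : #|T| <= B.
  rewrite cT; apply: leq_trans iU; apply: subset_leq_card; apply/subsetP=> _ /imsetP[s Ss ->].
  by apply/rcosetsP; exists (c ^ s) => //; rewrite groupJ // (subsetP sSG).
pose P t := (p ^ t) ^: L.
(* The first factor contains every [[~ c, t, l]]; the second will contain [[~ q, l]] for the element
   [q] comparing [s] with [t]. *)
pose D t := ([set [~ c, t]^-1] * ([~ c, t] ^: L)) * (P t * (P t)^-1).
apply: (@leq_trans #|\bigcup_(t in T) class_support (D t) L|); last first.
  apply: leq_trans (card_bigcup_le (m := ((k * (k * k)) * (k * k * (k * k)))%N) _) _.
    move=> t Tt; have St := subsetP sT t Tt; have [_ ct] := hS t St.
    have cPt : #|P t| <= k by rewrite card_classJ // nLS ?(subsetP sSG).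
    have cX x : x \in P t -> #|x ^: L| <= k.
      by case/imsetP=> l Ll ->; rewrite classGidl.
    apply: leq_trans (card_class_support_le (k := (k * k * (k * k))%N) _) _.
      move=> _ /mulsgP[_ _ /mulsgP[_ y /set1P-> cy ->] /mulsgP[x x' Px Px' ->] ->].
      apply: leq_trans (card_classM _ _ _) _; apply: leq_mul.
        apply: leq_trans (card_classM _ _ _) _; rewrite card_classV leq_mul //.
        by case/imsetP: cy => l Ll ->; rewrite classGidl.
      apply: leq_trans (card_classM _ _ _) _; apply: leq_mul; first exact: cX.
      by rewrite -card_classV; apply: cX; rewrite -mem_invg.
    rewrite leq_mul // (leq_trans (card_mulg_le _ _)) // leq_mul //.
      by rewrite (leq_trans (card_mulg_le _ _)) // cards1 mul1n.
    by rewrite (leq_trans (card_mulg_le _ _)) // card_invg leq_mul.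
  by rewrite leq_mul.
apply: subset_leq_card; apply/subsetP=> _ /imset2P[s l Ss Ll ->].
have [t Tt eU] := hT s Ss; have St := subsetP sT t Tt.
have [Gs Gt] := (subsetP sSG s Ss, subsetP sSG t St).
apply/bigcupP; exists t => //.
(* [q] lies in [L] as a quotient of two commutators, and in [U] because [c ^ s] and [c ^ t]
   represent the same coset; so, after conjugation by [t^-1], it commutes with the chosen
   conjugators of [p]. *)
pose q := (c ^ s)^-1 * c ^ t.
have eq : q = [~ c, s]^-1 * [~ c, t] by rewrite /q !commgEl [(c^-1 * _)^-1]invMg invgK -mulgA mulKVg.
have Lq : q \in L by rewrite eq groupM ?groupV //; [case: (hS s Ss) | case: (hS t St)].
have Uq : q \in U.
  have -> : q = (c ^ t * (c ^ s)^-1) ^ (c ^ s) by rewrite [RHS]conjgE mulgKV.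
  rewrite memJ_norm; first by rewrite -mem_rcoset -eU rcoset_refl.
  by rewrite (subsetP (normal_norm nU)) ?groupJ.
have key : [~ q, l] \in P t * (P t)^-1.
  apply: (@commg_class_maximal _ L (Z :^ t)) => //.
  - move=> m Lm; have [|z Zz ez] := pZ (m ^ t^-1); first by rewrite memJ_norm ?nLS ?groupV.
    exists (z ^ t); first by rewrite memJ_conjg.
    by rewrite -conjgM -conjgC conjgM ez -conjgM conjgC conjgKV conjgM.
  - move=> _ /imsetP[z Zz ->]; split; first by rewrite memJ_norm ?nLS ?ZL.
    have Uq' : q ^ t^-1 \in U by rewrite memJ_norm // (subsetP (normal_norm nU)) ?groupV.
    have Lq' : q ^ t^-1 \in L by rewrite memJ_norm // nLS ?groupV.
    have := cU z _ Zz Uq' Lq'; rewrite /commute => e.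
    by rewrite -[q](conjgKV t) -!conjMg e.
  - have e1 : p ^ t = (c ^ t)^-1 * c ^ (u * t) by rewrite /p commgEl conjMg conjVg conjgM.
    have e2 : [~ c, u * t * s^-1] ^ s = (c ^ s)^-1 * c ^ (u * t).
      by rewrite commgEl conjMg conjVg -[(c ^ _) ^ s]conjgM mulgKV.
    have -> : q * p ^ t = [~ c, u * t * s^-1] ^ s by rewrite e1 e2 /q -mulgA mulKVg.
    rewrite !card_classJ ?nLS //; apply: maxu.
    by rewrite !groupM ?groupV.
have -> : [~ c, s, l] = ([~ c, t, l] * [~ q, l]^-1) ^ q^-1.
  have -> : [~ c, s] = [~ c, t] * q^-1 by rewrite -[[~ c, t]](mulKVg [~ c, s]) -eq mulgK.
  by rewrite commMgJ [RHS]conjMg commVgJ.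
apply: memJ_class_support; last by rewrite groupV.
apply: mem_mulg; first by rewrite commgEl mem_mulg ?inE ?imset_f.
by rewrite -mem_invg invMg invgK.
Qed.

(** * The second derived subgroup *)

(* Modulo the centre, and in its action on the derived subgroup, every commutator
   behaves like an element with at most [k] conjugates. *)
Definition small_commutators (gT : finGroupType) (H : {group gT}) k :=
  forall x y, x \in H -> y \in H ->
  exists2 U : {group gT}, #|H : U| <= k & forall z, z \in H -> z \in U ->
    [~ x, y, z] \in 'Z(H) /\ (z \in H^`(1) -> [~ x, y, z] = 1).

(** [D x] is bounded for each single [x]. If [x0] maximises its size, then [D (x * x0) = D x0] for
    all [x] in some [U] of bounded index, and the union [Y] of these [D x] is bounded. Inside the
    centralizer of [Y] the commutators of [A] with the derived subgroup generate a bounded group,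
    which contains the second derived subgroup. *)
Lemma derived2_bounded k : exists N, forall (gT : finGroupType) (H : {group gT}),
    small_commutators H k ->
  exists H1 E : {group gT}, [/\ H1 \subset H, #|H : H1| <= N, E <| H1 /\ E \subset H1^`(1), #|E| <= N &
    H1^`(2) \subset E].
Proof.
have [n1 hn1] := commutators_fixed_left_bounded k.
pose b := (k ^ k)%N; pose B := ((b ^ n1) ^ (b ^ n1))%N.
pose n := (n1 * n1 * (k ^ 2 * k ^ 2))%N.
exists (B * n ^ n + n ^ n)%N => gT H cH.
pose L := H^`(1)%G; pose X := commg_set H H.
have nLH : L <| H := der_normal 1 H.
have sLH := normal_sub nLH.
have nLHx x : x \in H -> x \in 'N(L) by apply/subsetP/normal_norm.
have X1 : 1 \in X by rewrite -(comm1g 1) imset2_f.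
have eL : <<X>> = L by [].
have L_comm x y : x \in H -> y \in H -> [~ x, y] \in L.
  by move=> Hx Hy; rewrite /L /= derg1 mem_commg.
have nX c : c \in X -> nearly_central k H L c.
  case/imset2P=> x y Hx Hy ->; have [U iU hU] := cH x y Hx Hy.
  apply/existsP; exists U; rewrite iU /=; apply/subsetP=> v /setIP[Lv Uv].
  have [_ h] := hU v (subsetP sLH v Lv) Uv; apply/cent1P/commute_sym/commgP/eqP.
  exact: h.
have cX x s : x \in H -> s \in H -> [~ x, s] \in L /\ #|[~ x, s] ^: L| <= k.
  move=> Hx Hs; split; first exact: L_comm.
  have /nX/existsP[U /andP[iU cU]] : [~ x, s] \in X by apply: imset2_f.
  rewrite -index_cent1 -(indexgI L) /=; apply: leq_trans iU.
  apply: leq_trans (leq_indexSl U sLH).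
  by rewrite -(indexgI L U) leq_indexSr // !subsetI subsetIl.
pose D x := [set [~ x, s, z] | s in H, z in L].
have cD x : x \in H -> #|D x| <= n1.
  by move=> Hx; apply: (hn1 gT H H L X) => // s; apply: cX.
have [x0 Hx0 max0] := arg_maxnP (fun x => #|D x|) (group1 H : (fun x => x \in H) 1).
have k0 : 0 < k.
  have [_] := cX 1 1 (group1 H) (group1 H); apply: leq_trans.
  by rewrite card_gt0; apply/set0Pn; exists [~ 1, 1]; apply: class_refl.
(* Each element of [D x0] is attained with a nearly central last entry. Representatives with such
   entries have a common centralizer of bounded index, which supplies [U]. *)
pose good := [set p : gT * gT | [&& p.1 \in H, p.2 \in L & nearly_central b H L p.2]].
have [R [sR cR] hR] := exists_reps (fun p => [~ x0, p.1, p.2]) good.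
have sRD : (fun p => [~ x0, p.1, p.2]) @: good \subset D x0.
  apply/subsetP=> _ /imsetP[p gp ->]; move: gp; rewrite inE => /and3P[Hs Lz _].
  exact: imset2_f.
have cRn : #|R| <= n1 by rewrite cR (leq_trans (subset_leq_card sRD)) ?cD.
have b0 : 0 < b by rewrite expn_gt0 k0.
have [||U [nU iU] cU] := @nearly_central_common _ b n1 H L (snd @: R) b0.
- exact: leq_trans (leq_imset_card _ _) cRn.
- by move=> _ /imsetP[p /(subsetP sR) + ->]; rewrite inE => /and3P[].
have sUH := normal_sub nU; have nUHx x : x \in H -> x \in 'N(U) by apply/subsetP/normal_norm.
have R_D d : d \in D x0 -> exists2 p, p \in R & d = [~ x0, p.1, p.2].
  case/imset2P=> s l Hs Ll ->; have [_ cs] := cX x0 s Hx0 Hs.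
  have [z /andP[Lz gz] e] := class_nearly_central X1 eL nX cs Ll.
  have [|p Rp ep] := hR (s, z); first by rewrite inE /= Hs Lz.
  by exists p => //; rewrite ep /= !(commgEl [~ x0, s]) e.
have commU x s v z : x \in U -> s \in H -> v \in H -> z \in snd @: R -> commute z ([~ x, s] ^ v).
  move=> Ux Hs Hv Rz; have Hx := subsetP sUH x Ux; apply/commute_sym/cU => //.
    by rewrite memJ_norm ?nUHx // commgEl groupM ?groupV // memJ_norm ?nUHx.
  by rewrite memJ_norm ?nLHx ?L_comm.
have eD x : x \in U -> D (x * x0) = D x0.
  move=> Ux; have Hx := subsetP sUH x Ux.
  apply/esym/eqP; rewrite eqEcard; apply/andP; split; last by apply: max0; apply: groupM.
  apply/subsetP=> d /R_D[p Rp ->].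
  have := subsetP sR p Rp; rewrite inE => /and3P[Hp1 Lp2 _].
  apply/imset2P; exists p.1 p.2 => //; rewrite [[~ x * x0, p.1]]commMgJ [RHS]commMgJ.
  suff -> : [~ [~ x, p.1] ^ x0, p.2] = 1 by rewrite conj1g mul1g.
  by apply/eqP/commgP/commute_sym; apply: commU => //; apply: imset_f.
pose Y := \bigcup_(x in U) D x.
have sY : Y \subset class_support (D x0 * (D x0)^-1) L.
  apply/bigcupsP=> x Ux; apply/subsetP=> _ /imset2P[s l Hs Ll ->].
  have Hx := subsetP sUH x Ux.
  (* Chosen so that [[~ x' * x0, s'] = [~ x, s] * [~ x0, s']], which writes a conjugate of
     [[~ x, s, l]] as a quotient of two elements of [D x0]. *)
  pose x' := x ^ x0^-1; pose s' := s ^ x0^-1.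
  have Ux' : x' \in U by rewrite memJ_norm ?nUHx ?groupV.
  have Hs' : s' \in H by rewrite groupJ ?groupV.
  have e : [~ x', s'] ^ x0 = [~ x, s] by rewrite conjRg !conjgKV.
  have eb : [~ x, s, l] ^ [~ x0, s'] = [~ x' * x0, s', l] * [~ x0, s', l]^-1.
    by rewrite [[~ x' * x0, s']]commMgJ e [[~ _ * [~ x0, s'], l]]commMgJ mulgK.
  rewrite -[[~ x, s, l]](conjgK [~ x0, s']) eb; apply: memJ_class_support.
    apply: mem_mulg; last by rewrite inE invgK; apply: imset2_f.
    by rewrite -(eD x' Ux'); apply: imset2_f.
  by rewrite groupV L_comm.
have cDk d : d \in D x0 -> #|d ^: L| <= k ^ 2.
  by case/imset2P=> s l Hs Ll ->; apply: card_class_commg => //; case: (cX x0 s Hx0 Hs).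
have cY : #|Y| <= n.
  apply: leq_trans (subset_leq_card sY) _.
  apply: leq_trans (card_class_support_le (k := (k ^ 2 * k ^ 2)%N) _) _.
    move=> _ /mulsgP[d d' Dd Dd' ->]; apply: leq_trans (card_classM _ _ _) _.
    by apply: leq_mul; [exact: cDk | rewrite -card_classV; apply: cDk; rewrite -mem_invg].
  rewrite leq_mul // (leq_trans (card_mulg_le _ _)) // card_invg leq_mul ?cD //.
have sYH : Y \subset H.
  apply/bigcupsP=> x Ux; apply/subsetP=> _ /imset2P[s l Hs Ll ->].
  by have Hx := subsetP sUH x Ux; rewrite !groupR // (subsetP sLH).
have nYH : H \subset 'N(Y).
  apply/subsetP=> g Hg; rewrite inE; apply/subsetP=> _ /imsetP[_ /bigcupP[x Ux /imset2P[s l Hs Ll ->]] ->].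
  apply/bigcupP; exists (x ^ g); first by rewrite memJ_norm ?nUHx.
  by rewrite !conjRg; apply: imset2_f; [exact: groupJ | rewrite memJ_norm ?nLHx].
have [nM iM hM] := commutators_bounded sYH nYH cY.
pose H1 := (U :&: 'C_H(Y))%G; pose A := commg_set H1 H1.
have sH1H : H1 \subset H by rewrite subIset ?sUH.
have nH1H : H1 <| H by apply: normalI.
have sA : A \subset H1^`(1) by rewrite derg1 /commutator subset_gen.
have sE : [~: A, H1^`(1)] \subset H1^`(1).
  rewrite gen_subG; apply/subsetP=> _ /imset2P[a c Aa Lc ->].
  by rewrite groupR // (subsetP sA).
exists H1, [~: A, H1^`(1)]%G; split=> //.
- by rewrite (leq_trans (leq_index_setI _ _ _)) // (leq_trans (leq_mul iU iM)) ?leq_addr.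
- split; last exact: sE.
  rewrite /normal (subset_trans sE (der_sub 1 H1)) /=.
  apply: norms_commg; last exact: normal_norm (der_normal 1 H1).
  apply/subsetP=> g Hg; rewrite inE; apply/subsetP=> _ /imsetP[_ /imset2P[x y Hx Hy ->] ->].
  by rewrite conjRg imset2_f ?groupJ.
- rewrite (leq_trans (hM A (H1^`(1))%G _ _ _)) ?leq_addl //.
  + exact: subset_trans sA (subset_trans (der_sub 1 H1) sH1H).
  + exact: subset_trans (der_sub 1 H1) (subsetIr _ _).
  + move=> _ z /imset2P[x y /setIP[Ux Mx] /setIP[Uy My] ->] Lz; apply/bigcupP; exists x => //.
    by apply: imset2_f; [exact: (subsetP sUH) | exact: (subsetP (dergS 1 sH1H))].
- rewrite dergSn derg1 -{1}derg1 {1}derg1 {1}/commutator -/A.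
  apply: gen_commg_sub => [|a c Aa Lc]; last exact/mem_gen/imset2_f.
  apply: norms_commg.
    apply: subset_trans sA (subset_trans (der_sub 1 H1) _).
    apply/subsetP=> g Hg; rewrite inE; apply/subsetP=> _ /imsetP[_ /imset2P[x y Hx Hy ->] ->].
    by rewrite conjRg imset2_f ?groupJ.
  exact: subset_trans sA (subset_trans (der_sub 1 H1) (normal_norm (der_normal 1 H1))).
Qed.

(** * Four-fold commutators in metabelian groups *)

Lemma leq_card_imset_factor (T T1 T2 : finType) (A : {set T}) (f : T -> T1) (g : T -> T2) :
    (forall x y, x \in A -> y \in A -> f x = f y -> g x = g y) ->
  #|g @: A| <= #|f @: A|.
Proof.
move=> fg; have [S [sS <-] hS] := exists_reps f A.
apply: leq_trans (leq_imset_card g S); apply: subset_leq_card.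
apply/subsetP=> _ /imsetP[x Ax ->]; have [y Sy e] := hS x Ax.
by apply/imsetP; exists y => //; apply: fg => //; apply: (subsetP sS).
Qed.

Definition comm4 (gT : finGroupType) (c : gT) (t : gT * gT * gT) := [~ c, t.1.1, t.1.2, t.2].

Section Metabelian.
Variables (gT : finGroupType) (H : {group gT}).
Hypothesis abH : abelian H^`(1).
Implicit Types a b c u z w t : gT.

Lemma mem_commg_der c u : c \in H -> u \in H -> [~ c, u] \in H^`(1).
Proof. by move=> Hc Hu; rewrite derg1 mem_commg. Qed.

Lemma der_commgl a z : a \in H^`(1) -> z \in H -> [~ a, z] \in H^`(1).
Proof. by move=> La Hz; apply: mem_commg_der => //; apply: (subsetP (der_sub 1 H)). Qed.

Lemma derJ a u : a \in H^`(1) -> u \in H -> a ^ u \in H^`(1).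
Proof. by move=> La Hu; rewrite memJ_norm // (subsetP (normal_norm (der_normal 1 H))). Qed.

Lemma derC a b : a \in H^`(1) -> b \in H^`(1) -> commute a b.
Proof. by move=> La Lb; apply: (centsP abH). Qed.

Lemma derJ_id a b : a \in H^`(1) -> b \in H^`(1) -> a ^ b = a.
Proof. by move=> La Lb; apply/conjg_fixP/commgP/derC. Qed.

Lemma der_commMl a b z : a \in H^`(1) -> b \in H^`(1) -> z \in H ->
  [~ a * b, z] = [~ a, z] * [~ b, z].
Proof. by move=> La Lb Hz; rewrite commMgJ derJ_id // der_commgl. Qed.

Lemma der_commVl a z : a \in H^`(1) -> z \in H -> [~ a^-1, z] = [~ a, z]^-1.
Proof.
move=> La Hz; apply: (mulgI [~ a, z]).
by rewrite -der_commMl ?groupV // !mulgV comm1g.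
Qed.

(** [u * z] and [z * u] differ by a commutator, which acts trivially on the abelian derived
    subgroup. *)
Lemma der_commJl a u z : a \in H^`(1) -> u \in H -> z \in H ->
  [~ a ^ u, z] = [~ a, z] ^ u.
Proof.
move=> La Hu Hz; rewrite commgEl [[~ a, z]]commgEl [RHS]conjMg [a^-1 ^ u]conjVg; congr (_ * _).
rewrite -[LHS]conjgM -[RHS]conjgM.
by rewrite [u * z]commgC conjgM derJ_id ?mem_commg_der // derJ // groupM.
Qed.

Lemma der_commC a z w : a \in H^`(1) -> z \in H -> w \in H ->
  [~ a, z, w] = [~ a, w, z].
Proof.
move=> La Hz Hw; rewrite [[~ a, z]]commgEl der_commMl ?groupV ?derJ //.
by rewrite der_commVl // der_commJl // -commgEl.
Qed.

Lemma comm4_Ml c c' u z w : c \in H -> c' \in H -> u \in H -> z \in H -> w \in H ->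
  [~ c * c', u, z, w] = [~ c, u, z, w] ^ c' * [~ c', u, z, w].
Proof.
move=> Hc Hc' Hu Hz Hw; have d1 := mem_commg_der Hc Hu; have d2 := mem_commg_der Hc' Hu.
have -> : [~ c * c', u] = [~ c, u] ^ c' * [~ c', u] by rewrite commMgJ.
rewrite (der_commMl (derJ d1 Hc') d2 Hz) (der_commJl d1 Hc' Hz).
have d3 := der_commgl d1 Hz; have d4 := der_commgl d2 Hz.
by rewrite (der_commMl (derJ d3 Hc') d4 Hw) (der_commJl d3 Hc' Hw).
Qed.

Lemma comm4_C c u z w : c \in H -> u \in H -> z \in H -> w \in H ->
  [~ c, u, z, w] = [~ c, u, w, z].
Proof. by move=> *; rewrite der_commC ?mem_commg_der. Qed.

Lemma comm4_V c u z w : c \in H -> u \in H -> z \in H -> w \in H ->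
  [~ c, u, z, w] = [~ u, c, z, w]^-1.
Proof.
move=> Hc Hu Hz Hw; have d := mem_commg_der Hu Hc.
by rewrite -[[~ c, u]]invg_comm (der_commVl d Hz) (der_commVl (der_commgl d Hz) Hw).
Qed.

Lemma comm4_mem c u z w : c \in H -> u \in H -> z \in H -> w \in H ->
  [~ c, u, z, w] \in H^`(1).
Proof. by move=> *; do 2!apply: der_commgl => //; apply: mem_commg_der. Qed.

Lemma comm4_Mm c u u' z w : c \in H -> u \in H -> u' \in H -> z \in H -> w \in H ->
  [~ c, u * u', z, w] = [~ c, u, z, w] ^ u' * [~ c, u', z, w].
Proof.
move=> Hc Hu Hu' Hz Hw; rewrite comm4_V ?groupM // comm4_Ml // invMg -conjVg -!comm4_V //.
by apply: derC; rewrite ?derJ // comm4_mem.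
Qed.

Lemma comm4_Mr c u z w w' : c \in H -> u \in H -> z \in H -> w \in H -> w' \in H ->
  [~ c, u, z, w * w'] = [~ c, u, z, w'] * [~ c, u, z, w] ^ w'.
Proof. by move=> *; rewrite commgMJ. Qed.

Lemma comm4_Mz c u z z' w : c \in H -> u \in H -> z \in H -> z' \in H -> w \in H ->
  [~ c, u, z * z', w] = [~ c, u, z', w] * [~ c, u, z, w] ^ z'.
Proof. by move=> *; rewrite comm4_C ?groupM // comm4_Mr // ![[~ c, u, w, _]]comm4_C. Qed.

End Metabelian.

(** [R u z] says that [[~ c, u, z]] is centralised by [H]. After exchanging the entries, each [z] in
    [K] is good for a subgroup of [u] of bounded index, and [u |-> [~ c, u, z, w]] is a crossed
    homomorphism to which the maximality argument applies. *)
Lemma comm4_fixed_left_bounded k : exists N, forall (gT : finGroupType) (H : {group gT}),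
    abelian H^`(1) -> small_commutators H k -> forall c, c \in H ->
  exists2 K : {group gT}, K \subset H /\ #|H : K| <= N &
    #|comm4 c @: setX (setX H K) H| <= N.
Proof.
have [N1 hN1] := relation_core k.
have [N2 hN2] := crossed_hom_values_bounded (k * k)%N N1.
exists (N1 + N2)%N => gT H abH sH c Hc.
pose R u z := [forall w in H, [~ c, u, z, w] == 1].
have RP u z : reflect (forall w, w \in H -> [~ c, u, z, w] = 1) (R u z).
  by apply: (iffP forall_inP) => h w /h => [/eqP|->].
have hU u : u \in H -> exists2 U : {group gT}, #|H : U| <= k &
    forall z, z \in H -> z \in U -> R u z.
  move=> Hu; have [U iU hU] := sH c u Hc Hu; exists U => // z Hz Uz.
  apply/RP=> w Hw; have [/setIP[_ /centP h] _] := hU z Hz Uz.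
  by apply/eqP/commgP; apply: h.
have [||||| K [sK iK] hK] := hN1 gT H R => //.
- move=> u v z Hu Hv Hz /RP h1 /RP h2; apply/RP=> w Hw.
  by rewrite (comm4_Mm abH) // h1 // h2 // conj1g mulg1.
- move=> u z t Hu Hz Ht /RP h1 /RP h2; apply/RP=> w Hw.
  by rewrite (comm4_Mz abH) // h1 // h2 // conj1g mulg1.
- by move=> z Hz; apply/RP=> w Hw; rewrite commg1 !comm1g.
- by move=> u Hu; apply/RP=> w Hw; rewrite commg1 !comm1g.
exists K; first by rewrite (leq_trans iK) ?leq_addr.
have sKH x : x \in K -> x \in H by apply/subsetP.
pose f u (j : gT * gT) := [~ c, u, j.1, j.2].
apply: (@leq_trans #|\bigcup_(u in H) f u @: setX K H|).
  apply: subset_leq_card; apply/subsetP=> _ /imsetP[t + ->].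
  case: t => [[u z] w]; rewrite !inE /= => /andP[/andP[Hu Kz] Hw]; apply/bigcupP; exists u => //.
  by apply/imsetP; exists (z, w); rewrite // inE Kz.
apply: leq_trans (leq_addl _ _); apply: hN2.
- move=> u v [z w] Hu Hv; rewrite inE /= => /andP[Kz Hw].
  by rewrite /f /= (comm4_Mm abH) // sKH.
(* For fixed [u] both [z] and [w], by symmetry, matter only modulo [U]: at most [k * k] values. *)
- move=> u Hu; have [U iU hU'] := hU u Hu.
  have [S [sS cS] hS] := exists_coset_reps H U.
  apply: (@leq_trans #|f u @: setX S S|); last first.
    by rewrite (leq_trans (leq_imset_card _ _)) // cardsX cS leq_mul.
  apply: subset_leq_card; apply/subsetP=> _ /imsetP[t + ->].
  case: t => [z w]; rewrite inE /= => /andP[/sKH Hz Hw].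
  have [z' Sz' Uz] := hS z Hz; have [w' Sw' Uw] := hS w Hw.
  have Hz' := subsetP sS _ Sz'; have Hw' := subsetP sS _ Sw'.
  apply/imsetP; exists (z', w'); rewrite ?inE ?Sz' // /f /=.
  rewrite -{1}[z](mulgKV z') (comm4_Mz abH) ?groupM ?groupV //.
  have /RP-> // : R u (z * z'^-1) by apply: hU' => //; rewrite groupM ?groupV.
  rewrite conj1g mulg1 (comm4_C abH) // [RHS](comm4_C abH) //.
  rewrite -{1}[w](mulgKV w') (comm4_Mz abH) ?groupM ?groupV //.
  have /RP-> // : R u (w * w'^-1) by apply: hU' => //; rewrite groupM ?groupV.
  by rewrite conj1g mulg1.
- move=> [z w]; rewrite inE /= => /andP[Kz Hw].
  have [T [sT iT] hT] := hK z Kz; exists T => // v Hv Tv.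
  by have /RP := hT v Tv; apply.
Qed.

Section ValueCount.
Variables (gT : finGroupType) (H : {group gT}).
Hypothesis abH : abelian H^`(1).

Definition comm4_values c w := [set [~ c, u, z, w] | u in H, z in H].

Lemma comm4_values_submultiplicative (K : {group gT}) :
  K \subset H -> submultiplicative H K (fun c w => #|comm4_values c w|).
Proof.
move=> sK; have sKH x : x \in K -> x \in H by apply/subsetP.
have inj1 c (A : {set gT}) : #|A :^ c| = #|A| by apply: cardJg.
split.
- move=> c c' w Hc Hc' /sKH Hw; rewrite -(inj1 c' (comm4_values c w)).
  apply: leq_trans (card_mulg_le _ _); apply: subset_leq_card.
  apply/subsetP=> _ /imset2P[u z Hu Hz ->]; rewrite (comm4_Ml abH) //.
  by rewrite mem_mulg ?memJ_conjg //; apply: imset2_f.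
- move=> c w w' Hc /sKH Hw /sKH Hw'; rewrite mulnC -(inj1 w' (comm4_values c w)).
  apply: leq_trans (card_mulg_le _ _); apply: subset_leq_card.
  apply/subsetP=> _ /imset2P[u z Hu Hz ->]; rewrite commgMJ.
  by rewrite mem_mulg ?memJ_conjg //; apply: imset2_f.
- move=> c w Hc /sKH Hw; rewrite -(inj1 c^-1 (comm4_values c w)) -[leqRHS]card_invg.
  apply: subset_leq_card; apply/subsetP=> _ /imset2P[u z Hu Hz ->]; rewrite mem_invg.
  have : [~ c * c^-1, u, z, w] = 1 by rewrite mulgV !comm1g.
  rewrite (comm4_Ml abH) ?groupV // => /(canRL (mulKg _)) ->.
  by rewrite mulg1 invgK memJ_conjg; apply: imset2_f.
- move=> c w Hc /sKH Hw; rewrite -(inj1 w^-1 (comm4_values c w)) -[leqRHS]card_invg.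
  apply: subset_leq_card; apply/subsetP=> _ /imset2P[u z Hu Hz ->]; rewrite mem_invg.
  have : [~ c, u, z, w * w^-1] = 1 by rewrite mulgV commg1.
  rewrite commgMJ => /(canRL (mulgK _)) ->.
  by rewrite mul1g invgK memJ_conjg; apply: imset2_f.
- move=> w _; apply: (@leq_trans #|[set (1 : gT)]|); last by rewrite cards1.
  apply: subset_leq_card; apply/subsetP=> _ /imset2P[u z Hu Hz ->].
  by rewrite !comm1g inE.
- move=> c _; apply: (@leq_trans #|[set (1 : gT)]|); last by rewrite cards1.
  apply: subset_leq_card; apply/subsetP=> _ /imset2P[u z Hu Hz ->].
  by rewrite commg1 inE.
Qed.

End ValueCount.

(** Sets of commutators are normalised by [M], so generators suffice in the left entries. This is
    the form in which bounded values of four-fold commutators bound ['L_4(M)]. *)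
Lemma lcn4_sub_commg (gT : finGroupType) (M : {group gT}) :
  'L_4(M) \subset [~: commg_set (commg_set M M) M, M].
Proof.
have nM (A B : {set gT}) : M \subset 'N(A) -> M \subset 'N(B) -> M \subset 'N(commg_set A B).
  move=> nA nB; apply/subsetP=> g Mg; rewrite inE; apply/subsetP=> _ /imsetP[_ /imset2P[a b Aa Bb ->] ->].
  by rewrite conjRg imset2_f // memJ_norm ?(subsetP nA) ?(subsetP nB).
have nM2 := nM M M (normG M) (normG M); have nM3 := nM _ M nM2 (normG M).
have sM2 : commg_set M M \subset M.
  by apply/subsetP=> _ /imset2P[a b Ma Mb ->]; rewrite groupR.
have sM3 : commg_set (commg_set M M) M \subset M.
  by apply/subsetP=> _ /imset2P[a b Ma Mb ->]; rewrite groupR // (subsetP sM2).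
have s3 : 'L_3(M) \subset <<commg_set (commg_set M M) M>>.
  rewrite [in 'L_3(M)]lcnSn lcn2; apply: gen_commg_sub.
    exact: subset_trans sM2 (norms_gen nM3).
  by move=> a b Ma Mb; apply/mem_gen/imset2_f.
rewrite lcnSn; apply: subset_trans (commSg M s3) _; apply: gen_commg_sub.
  by apply: subset_trans sM3 _; apply: norms_commg => //; apply: normG.
by move=> a b Ma Mb; apply/mem_gen/imset2_f.
Qed.

(** The subgroup belonging to a fixed [c] varies with [c]. Comparison with a generic [c0] replaces
    it by [L], built from the subgroup of [c0], at least when [w] is fixed too; the variation of [w]
    is then absorbed by the subgroup of [c] itself. *)
Lemma comm4_bounded_subgroup k : exists N, forall (gT : finGroupType) (H : {group gT}),
    abelian H^`(1) -> small_commutators H k ->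
  exists2 K : {group gT}, K \subset H /\ #|H : K| <= N &
    forall c, c \in K -> #|comm4 c @: setX (setX K K) K| <= N.
Proof.
have [N1 hN1] := comm4_fixed_left_bounded k.
have [N2 hN2] := submultiplicative_core N1.
have [N3 hN3] := generic_point (N1 + N2)%N.
pose n3 := (N1 + N2)%N; pose k' := (n3 * N1 * N3 * N1)%N.
exists (N3 * (N1 * N2) + N1 * (k' * N1))%N => gT H abH sH.
have hE := hN1 gT H abH sH.
pose mu c w := #|comm4_values H c w|.
have smH := comm4_values_submultiplicative abH (subxx H).
have muE c : c \in H -> exists2 K : {group gT}, K \subset H /\ #|H : K| <= N1 &
    #|comm4 c @: setX (setX H K) H| <= N1 /\ forall w, w \in K -> mu c w <= N1.
  move=> Hc; have [K [sK iK] cK] := hE c Hc; exists K => //; split=> // w Kw.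
  apply: leq_trans cK; apply: subset_leq_card; apply/subsetP=> _ /imset2P[u z Hu Hz ->].
  have Hw := subsetP sK w Kw; apply/imsetP; exists (u, w, z); first by rewrite !inE Hu Kw.
  by rewrite /comm4 /= (comm4_C abH).
have [||Hs [sHs iHs] hT] := hN2 gT H mu.
- exact: smH.
- apply: large_sections_sum => c Hc; have [K [sK iK] [_ hK]] := muE c Hc.
  by exists K => // w Hw Kw; apply: hK.
have sHsH x : x \in Hs -> x \in H by apply/subsetP.
have smHs := comm4_values_submultiplicative abH sHs.
have [||c0 [W [V [Hc0 [sW cW] [sV iV] hVW hV]]]] := hN3 gT H Hs mu smHs.
- move=> c Hc; have [K [sK iK] [_ hK]] := muE c Hc; exists K.
    by rewrite (leq_trans (leq_indexSl _ sHs)) // (leq_trans iK) ?leq_addr.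
  by move=> w _ Kw; rewrite (leq_trans (hK w Kw)) ?leq_addr.
- move=> w Hw; have [T [sT iT] hTw] := hT w Hw; exists T; first by rewrite (leq_trans iT) ?leq_addl.
  by move=> c _ Tc; rewrite (leq_trans (hTw c Tc)) ?leq_addl.
have [K0 [sK0 iK0] [cK0 hK0]] := muE c0 Hc0.
pose L := (K0 :&: Hs)%G.
have sLH : L \subset H by rewrite subIset ?sK0.
have LH x : x \in L -> x \in H by apply/subsetP.
have VH x : x \in V -> x \in H by apply/subsetP.
pose E0 := comm4 c0 @: setX (setX H K0) H.
have E0P u z w : u \in H -> z \in L -> w \in H -> [~ c0, u, z, w] \in E0.
  by move=> Hu /setIP[Kz _] Hw; apply/imsetP; exists (u, z, w); rewrite // !inE Hu Kz.
pose S c w := [set [~ c, u, z, w] | u in H, z in L].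
(* Expanding [[~ c * c0, u, z, w]] in [c * c0] and in [w = (w * w'^-1) * w'] leaves four factors:
   two are bounded by genericity, and the two with left entry [c0] lie in [E0] because [z] is in
   [K0]. *)
have cS c w : c \in V -> w \in L -> #|S c w| <= k'.
  move=> Vc Lw; have Hc := VH c Vc; have Hw := LH w Lw; have /setIP[_ Hsw] := Lw.
  have [w' Ww' cw'] := hV c w Vc Hsw.
  have Hsw' := subsetP sW w' Ww'; have Hw' := sHsH w' Hsw'.
  have Hww : w * w'^-1 \in H by rewrite groupM ?groupV.
  have Hcc : c * c0 \in H by rewrite groupM.
  rewrite -(cardJg (S c w) c0).
  apply: (@leq_trans #|(comm4_values H c w' :^ c0 * E0) * (comm4_values H (c * c0) (w * w'^-1) :^ w') * E0^-1|).
    apply: subset_leq_card; apply/subsetP=> _ /imsetP[_ /imset2P[u z Hu Lz ->] ->].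
    have Hz := LH z Lz.
    have -> : [~ c, u, z, w] ^ c0 = [~ c, u, z, w'] ^ c0 * [~ c0, u, z, w'] *
         [~ c * c0, u, z, w * w'^-1] ^ w' * [~ c0, u, z, w]^-1.
      rewrite -(comm4_Ml abH) // -(comm4_Mr _ _ _ Hww Hw') //.
      by rewrite mulgKV (comm4_Ml abH) // mulgK.
    apply: mem_mulg; last by rewrite inE invgK E0P.
    apply: mem_mulg; last by rewrite memJ_conjg; apply: imset2_f.
    apply: mem_mulg; last exact: E0P.
    by rewrite memJ_conjg; apply: imset2_f.
  apply: leq_trans (card_mulg_le _ _) _; rewrite card_invg /k'; apply: leq_mul => //.
  apply: leq_trans (card_mulg_le _ _) _; rewrite cardJg; apply: leq_mul => //.
  apply: leq_trans (card_mulg_le _ _) _; rewrite cardJg; apply: leq_mul => //.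
  exact: hVW.
exists (V :&: L)%G; first split.
- by rewrite subIset // sV.
- rewrite (leq_trans (leq_index_setI _ _ _)) // (leq_trans _ (leq_addr _ _)) // leq_mul //.
  by rewrite (leq_trans (leq_index_setI _ _ _)) // leq_mul.
move=> c /setIP[Vc _]; have Hc := VH c Vc.
have [Kc [sKc iKc] [cKc hKc]] := muE c Hc.
have [T [sT cT] hTc] := exists_coset_reps L Kc.
have cT' : #|T| <= N1 by rewrite cT (leq_trans (leq_indexSl _ sLH)).
pose Ec := comm4 c @: setX (setX H Kc) H.
(* With [w = (w * t^-1) * t], the part at [t] lies in [S c t], and the part at [w * t^-1] in a
   conjugate of [Ec]. *)
apply: (@leq_trans #|\bigcup_(t in T) (S c t * (Ec :^ t))|); last first.
  apply: leq_trans (leq_addl _ _); apply: leq_trans (card_bigcup_le (m := (k' * N1)%N) _) _.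
    move=> t Tt; rewrite (leq_trans (card_mulg_le _ _)) // cardJg leq_mul // cS //.
    exact: (subsetP sT).
  by rewrite leq_mul.
apply: subset_leq_card; apply/subsetP=> _ /imsetP[j + ->]; case: j => [[u z] w].
rewrite in_setX in_setX => /andP[/andP[/= /setIP[Vu _] /setIP[_ Lz]] /setIP[_ Lw]].
have [t Tt Kt] := hTc w Lw; have Lt := subsetP sT t Tt.
have [Hu Hz Hw Ht] := And4 (VH u Vu) (LH z Lz) (LH w Lw) (LH t Lt).
apply/bigcupP; exists t => //; rewrite /comm4 /= -[w](mulgKV t) commgMJ.
apply: mem_mulg; first exact: imset2_f.
rewrite memJ_conjg; apply/imsetP; exists (u, w * t^-1, z).
  by rewrite !in_setX /= Hu Kt.
by rewrite /comm4 /= (comm4_C abH) // groupM ?groupV.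
Qed.

(** The maximality argument in [c] bounds the set [Y] of all four-fold commutators of [K]; in the
    centralizer of [Y] these generate a bounded group. *)
Lemma lcn4_bounded_metabelian k : exists N, forall (gT : finGroupType) (H : {group gT}),
    abelian H^`(1) -> small_commutators H k ->
  exists2 M : {group gT}, M \subset H /\ #|H : M| <= N & #|'L_4(M)| <= N.
Proof.
have [N1 hN1] := comm4_bounded_subgroup k.
have [N2 hN2] := crossed_hom_values_bounded N1 N1.
exists (N1 * N2 ^ N2 + N2 ^ N2)%N => gT H abH sH.
have [K [sK iK] cK] := hN1 gT H abH sH.
have KH x : x \in K -> x \in H by apply/subsetP.
pose P := setX (setX K K) K.
have cY := hN2 gT _ K P (fun c j => comm4 c j).
set Y := \bigcup_(c in K) comm4 c @: P in cY.
have {}cY : #|Y| <= N2.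
  apply: cY => //.
  - move=> u v [[x y] z] Ku Kv; rewrite !in_setX /= => /andP[/andP[Kx Ky] Kz].
    by rewrite /comm4 /= (comm4_Ml abH) ?KH.
  - move=> [[u z] w]; rewrite !in_setX /= => /andP[/andP[Ku Kz] Kw].
    have [Hu Hz Hw] := And3 (KH u Ku) (KH z Kz) (KH w Kw).
    (* The index of [U] is at most the number of values of [c |-> [~ c, u, z, w]]. By antisymmetry
       these are inverses of values with fixed left entry [u], already bounded. *)
    pose U := [set c in K | [~ c, u, z, w] == 1].
    have gU : group_set U.
      apply/group_setP; split; first by rewrite inE group1 !comm1g /=.
      move=> c c'; rewrite !inE => /andP[Kc /eqP e] /andP[Kc' /eqP e'].
      by rewrite groupM //= (comm4_Ml abH) ?KH // e e' conj1g mulg1.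
    exists (Group gU); last by move=> v _; rewrite inE /comm4 /= => /andP[_ /eqP].
    have -> : #|K : Group gU| = #|(fun c => U :* c) @: K|.
      by apply: eq_card => X; apply/rcosetsP/imsetP => -[c]; exists c.
    apply: leq_trans (leq_card_imset_factor (f := fun c => [~ c, u, z, w]) _) _.
      move=> x y Kx Ky e; apply/(@rcoset_eqP _ (Group gU)); rewrite mem_rcoset inE groupM ?groupV //=.
      have := comm4_Ml abH (c := x * y^-1) (c' := y) (u := u) (z := z) (w := w).
      rewrite mulgKV => /(_ _ _ Hu Hz Hw); rewrite groupM ?groupV ?KH // => /(_ isT isT).
      rewrite e => /esym/(canRL (mulgK _)); rewrite mulgV => /(canRL (conjgK _)) ->.
      by rewrite conj1g.
    apply: leq_trans (cK u Ku); rewrite -[leqRHS]card_invg; apply: subset_leq_card.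
    apply/subsetP=> _ /imsetP[c Kc ->]; rewrite mem_invg (comm4_V abH) ?KH // invgK.
    by apply/imsetP; exists (c, z, w); rewrite // !in_setX /= Kc Kz.
have sYK : Y \subset K.
  apply/bigcupsP=> c Kc; apply/subsetP=> _ /imsetP[j + ->]; case: j => [[u z] w].
  by rewrite !in_setX /= => /andP[/andP[Ku Kz] Kw]; rewrite /comm4 /= !groupR.
have nYK : K \subset 'N(Y).
  apply/subsetP=> g Kg; rewrite inE; apply/subsetP=> _ /imsetP[_ /bigcupP[c Kc /imsetP[j + ->]] ->].
  case: j => [[u z] w]; rewrite !in_setX /= => /andP[/andP[Ku Kz] Kw].
  apply/bigcupP; exists (c ^ g); first exact: groupJ.
  apply/imsetP; exists (u ^ g, z ^ g, w ^ g); first by rewrite !in_setX /= !groupJ.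
  by rewrite /comm4 /= !conjRg.
have [nM iM hM] := commutators_bounded sYK nYK cY.
have sMK := normal_sub nM.
exists 'C_K(Y)%G; first split.
- exact: subset_trans sMK sK.
- rewrite (leq_trans (leq_index_trans _ sK)) // (leq_trans _ (leq_addr _ _)) //.
  by rewrite leq_mul.
- apply: leq_trans (leq_addl _ _).
  apply: leq_trans (subset_leq_card (lcn4_sub_commg _)) _; apply: hM => //=.
    apply/subsetP=> _ /imset2P[_ w /imset2P[c u Mc Mu ->] Mw ->].
    by rewrite !groupR // (subsetP sMK).
  move=> _ w /imset2P[_ z /imset2P[c u Mc Mu ->] Mz ->] Mw.
  apply/bigcupP; exists c; first exact: (subsetP sMK).
  apply/imsetP; exists (u, z, w) => //.
  by rewrite !in_setX /= !(subsetP sMK).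
Qed.

(** * Central commutators modulo a bounded subgroup *)

Lemma norm_class_support (gT : finGroupType) (G : {group gT}) (A : {set gT}) :
  G \subset 'N(class_support A G).
Proof.
apply/subsetP=> g Gg; rewrite inE; apply/subsetP=> _ /imsetP[_ /imset2P[a x Aa Gx ->] ->].
by rewrite -conjgM memJ_class_support ?groupM.
Qed.

Lemma sub_class_support_group (gT : finGroupType) (G : {group gT}) (A : {set gT}) :
  A \subset G -> class_support A G \subset G.
Proof.
by move=> sAG; apply/subsetP=> _ /imset2P[a x Aa Gx ->]; rewrite groupJ // (subsetP sAG).
Qed.

(* Turns a bound on the values [~ a, b] into a normal subgroup containing them,
   at the price of restricting [b] to a subgroup of bounded index. *)
Lemma class_support_commutators (gT : finGroupType) (G B : {group gT}) (A Y : {set gT}) n k :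
    A \subset G -> B <| G -> Y \subset G -> #|Y| <= n ->
    (forall y, y \in Y -> #|y ^: G| <= k) ->
    (forall a b, a \in A -> b \in B -> [~ a, b] \in class_support Y G) ->
  let m := ((n * k) ^ (n * k))%N in
  exists E M : {group gT}, [/\ E <| G /\ E \subset B, #|E| <= m, M <| G, #|G : M| <= m &
    forall a b, a \in A -> b \in B -> b \in M -> [~ a, b] \in E].
Proof.
move=> sAG nBG sYG cY cYk hAB m.
have sY' := sub_class_support_group sYG; have nY' := norm_class_support G Y.
have cY' : #|class_support Y G| <= n * k.
  by rewrite (leq_trans (card_class_support_le cYk)) // leq_mul.
have [nM iM hM] := commutators_bounded sY' nY' cY'.
set M := ('C_G(class_support Y G))%G in nM iM hM.
pose A' := class_support A G; have sA' : A' \subset G := sub_class_support_group sAG.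
have nBM : (B :&: M)%G <| G by apply: normalI.
exists [~: A', B :&: M]%G, M; split=> //; first split.
- rewrite /normal /=; apply/andP; split.
    rewrite gen_subG; apply/subsetP=> _ /imset2P[a b Aa /setIP[Bb _] ->].
    by apply: groupR; [exact: (subsetP sA') | exact: (subsetP (normal_sub nBG))].
  by apply: norms_commg; [exact: norm_class_support | exact: normal_norm].
- rewrite gen_subG; apply/subsetP=> _ /imset2P[a b Aa /setIP[Bb _] ->].
  rewrite commgEr groupM // memJ_norm ?groupV // (subsetP (normal_norm nBG)) //.
  exact: (subsetP sA').
- apply: (hM A' (B :&: M)%G) => //; first exact: subsetIr.
  move=> _ b /imset2P[a x Aa Gx ->] /setIP[Bb _].
  have Bb' : b ^ x^-1 \in B by rewrite memJ_norm // (subsetP (normal_norm nBG)) ?groupV.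
  rewrite -[b](conjgKV x) -conjRg memJ_norm ?(subsetP nY') //; exact: hAB.
- move=> a b Aa Bb Mb; apply/mem_gen/imset2_f; first exact: mem_class_support.
  by rewrite inE Bb.
Qed.

Definition commutators_often_small (gT : finGroupType) (G : {group gT}) n :=
  forall x, x \in G -> exists2 S : {group gT}, #|G : S| <= n &
    forall s, s \in G -> s \in S -> #|[~ x, s] ^: G| <= n.

Definition small_class (gT : finGroupType) (G : {group gT}) n := [set g in G | #|g ^: G| <= n].

Lemma small_class_norm (gT : finGroupType) (G : {group gT}) n : G \subset 'N(small_class G n).
Proof.
apply/subsetP=> g Gg; rewrite inE; apply/subsetP=> _ /imsetP[x + ->].
by rewrite !inE => /andP[Gx cx]; rewrite groupJ // classGidl.
Qed.

Lemma small_class_gen_normal (gT : finGroupType) (G : {group gT}) n : <<small_class G n>> <| G.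
Proof.
rewrite /normal norms_gen ?small_class_norm // gen_subG andbT.
by apply/subsetP=> x; rewrite inE => /andP[].
Qed.

(** Elements of small class have centralizers of bounded index, so they are nearly central
    generators of the group [L] they generate, and the bound for a fixed left entry applies to
    [[~ c, s, z]] with [z] in [L]. *)
Lemma fixed_left_small_class n : exists N, forall (gT : finGroupType) (G : {group gT}) c,
    commutators_often_small G n -> c \in G ->
  exists E M : {group gT}, [/\ E <| G /\ E \subset <<small_class G n>>, #|E| <= N, M <| G, #|G : M| <= N &
    (forall s, s \in M -> #|[~ c, s] ^: G| <= n) /\
    (forall s z, s \in M -> z \in M -> z \in <<small_class G n>> -> [~ c, s, z] \in E)].
Proof.
have [N1 hN1] := commutators_fixed_left_bounded n.
pose m := ((N1 * n ^ 2) ^ (N1 * n ^ 2))%N.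
exists (n ^ n * m + m)%N => gT G c hG Gc.
have [S iS hS] := hG c Gc.
have n0 : 0 < n := leq_trans (indexg_gt0 _ _) iS.
have [S' [nS' iS'] sS'] := index_core iS.
have sS'G := normal_sub nS'.
pose L := <<small_class G n>>%G.
have nL : L <| G := small_class_gen_normal G n.
have cS s : s \in S' -> #|[~ c, s] ^: G| <= n.
  by move=> Ss; apply: hS; [exact: (subsetP sS'G) | exact: (subsetP sS')].
have GcS s : s \in S' -> [~ c, s] \in G by move=> Ss; rewrite groupR // (subsetP sS'G).
pose Y := [set [~ c, s, z] | s in S', z in L].
have cY : #|Y| <= N1.
  apply: (hN1 gT G S' L (small_class G n)) => //.
  - by rewrite inE group1 class1G cards1.
  - move=> x; rewrite inE => /andP[Gx cx]; apply/existsP; exists 'C_G[x]%G.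
    by rewrite index_cent1 cx /= (subset_trans (subsetIr _ _)) ?subsetIr.
  - move=> s Ss; split; first by apply: mem_gen; rewrite inE GcS ?cS.
    by rewrite (leq_trans (card_class_subl _ (normal_sub nL))) ?cS.
have [||||E [M [nE cE nM iM hM]]] := @class_support_commutators gT G L [set [~ c, s] | s in S'] Y N1 (n ^ 2) _ nL _ cY.
- by apply/subsetP=> _ /imsetP[s Ss ->]; apply: GcS.
- apply/subsetP=> _ /imset2P[s z Ss Lz ->].
  by rewrite groupR ?GcS // (subsetP (normal_sub nL)).
- move=> _ /imset2P[s z Ss Lz ->]; apply: card_class_commg; last exact: cS.
  exact: (subsetP (normal_sub nL)).
- by move=> _ b /imsetP[s Ss ->] Lb; apply: mem_class_support; apply: imset2_f.
exists E, (S' :&: M)%G; split=> //.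
- by rewrite (leq_trans cE) ?leq_addl.
- exact: normalI.
- rewrite (leq_trans (leq_index_setI _ _ _)) // (leq_trans _ (leq_addr _ _)) //.
  by rewrite leq_mul.
split=> [s /setIP[Ss _] | s z /setIP[Ss _] /setIP[_ Mz] Lz]; first exact: cS.
by apply: hM => //; apply: imset_f.
Qed.

(** Maximality once more: let [p = [~ c, u0]] have the largest class. For [v] in a subgroup of
    bounded index, [[~ c, v]] commutes with representative conjugators of [p], so its commutators
    with [H2] lie in conjugates of a bounded set [Y]. *)
Lemma fixed_left_central n : exists N,
  forall (gT : finGroupType) (G H L : {group gT}) c,
    H <| G -> L <| G -> c \in G -> #|G : H| <= n ->
    (forall s, s \in H -> #|[~ c, s] ^: G| <= n) ->
    (forall s z, s \in H -> z \in H -> z \in L -> [~ c, s, z] = 1) ->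
    (forall u, u \in G -> exists2 R : {group gT}, #|G : R| <= n &
       forall z, z \in G -> z \in R -> [~ u, z] \in L) ->
  exists E K : {group gT}, [/\ E <| G, #|E| <= N, K <| G, #|G : K| <= N &
    forall v z, v \in K -> z \in K -> [~ c, v, z] \in E].
Proof.
have [N1 hN1] := relation_core (n * n)%N.
pose b1 := ((n * N1) ^ (n * N1))%N; pose b2 := ((n * N1 ^ n) ^ (n * N1 ^ n))%N.
pose m := ((n * n * (n * n)) ^ (n * n * (n * n)))%N.
exists (b1 * (b2 * m) + m)%N => gT G H L c nH nL Gc iH cH hHL hL.
have sHG := normal_sub nH.
have GH x : x \in H -> x \in G by apply/subsetP.
(* The condition [[~ u, z] \in L] makes [R] multiplicative in [u]: shifting a conjugation by [v]
   from [[~ c, u]] to [z] changes [z] by an element of [L], which commutes with [[~ c, u]]. *)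
pose R u z := ([~ c, u, z] == 1) && ([~ u, z] \in L).
have nLx x : x \in G -> x \in 'N(L) by apply/subsetP/normal_norm.
have [||||| H1 [sH1 iH1] hH1] := hN1 gT H R.
- move=> u v z Hu Hv Hz /andP[/eqP e1 l1] /andP[/eqP e2 l2]; apply/andP; split; last first.
    by rewrite commMgJ groupM // memJ_norm ?nLx ?GH.
  have l3 : [~ z, v^-1] \in L.
    by rewrite -invg_comm commVgJ groupV memJ_norm ?groupV // nLx ?groupV ?GH.
  rewrite commgMJ commMgJ e2 conj1g mul1g.
  rewrite -[z](conjgKV v) -conjRg [z ^ v^-1]conjg_mulR commgMJ e1 conj1g mulg1 hHL ?conj1g //.
  by rewrite groupR ?groupV.
- move=> u z t Hu Hz Ht /andP[/eqP e1 l1] /andP[/eqP e2 l2]; apply/andP; split.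
    by rewrite commgMJ e1 e2 conj1g mulg1.
  by rewrite commgMJ groupM // memJ_norm ?nLx ?GH.
- by move=> z Hz; rewrite /R commg1 !comm1g group1 eqxx.
- by move=> u Hu; rewrite /R !commg1 group1 eqxx.
- move=> u Hu; have [R' iR' hR'] := hL u (GH u Hu).
  exists ('C_G[[~ c, u]] :&: R')%G.
    rewrite (leq_trans (leq_indexSl _ sHG)) // (leq_trans (leq_index_setI _ _ _)) // leq_mul //.
    by rewrite index_cent1 cH.
  move=> z Hz /setIP[/setIP[_ cz] Rz]; rewrite /R hR' ?GH // andbT.
  by apply/commgP/commute_sym/cent1P.
have iGH1 : #|G : H1| <= n * N1 by rewrite (leq_trans (leq_index_trans _ sHG)) ?leq_mul.
have [H2 [nH2 iH2] sH2] := index_core iGH1.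
have sH2G := normal_sub nH2.
have [u0 Hu0 max0] := arg_maxnP (fun s => #|[~ c, s] ^: H2|) (group1 H : (fun x => x \in H) 1).
set p := [~ c, u0] in max0 *.
have cp : #|p ^: H2| <= n by rewrite (leq_trans (card_class_subl _ sH2G)) ?cH.
have [Z [sZ cZ] hZ] := exists_reps (conjg p) H2.
have cZn : #|Z| <= n by rewrite cZ.
have N10 : 0 < N1 := leq_trans (indexg_gt0 _ _) iH1.
have [|U [sU iU] hU] := @index_bigI _ _ Z (fun z v => R v z) H n N1 N10 cZn.
  move=> z Zz; have [T [sT iT] hT] := hH1 z (subsetP sH2 z (subsetP sZ z Zz)).
  by exists T.
have iGU : #|G : U| <= n * N1 ^ n by rewrite (leq_trans (leq_index_trans _ sHG)) ?leq_mul.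
have [U' [nU' iU'] sU'] := index_core iGU.
have sU'H : U' \subset H := subset_trans sU' sU.
pose Y := (p ^: H2) * (p ^: H2)^-1.
have VY y : y \in Y -> y^-1 \in Y.
  by case/mulsgP=> x x' px px' ->; rewrite invMg mem_mulg // ?inE ?invgK // -mem_invg.
have cY : #|Y| <= n * n by rewrite (leq_trans (card_mulg_le _ _)) // card_invg leq_mul.
have Gp : p \in G by rewrite /p groupR // GH.
have pG x : x \in p ^: H2 -> x \in G.
  by case/imsetP=> h Hh ->; rewrite groupJ // (subsetP sH2G).
have sY : Y \subset G.
  apply/subsetP=> _ /mulsgP[x x' px px' ->]; apply: groupM; first exact: pG.
  by rewrite -groupV; apply: pG; rewrite -mem_invg.
have cp' x : x \in p ^: H2 -> #|x ^: G| <= n.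
  by case/imsetP=> h Hh ->; rewrite classGidl ?cH // (subsetP sH2G).
have cYk y : y \in Y -> #|y ^: G| <= n * n.
  case/mulsgP=> x x' px px' ->; apply: leq_trans (card_classM _ _ _) _; apply: leq_mul; first exact: cp'.
  by rewrite -card_classV; apply: cp'; rewrite -mem_invg.
have key v l : v \in U -> l \in H2 -> [~ c, v, l] \in class_support Y G.
  move=> Uv Hl; have Hv := subsetP sU v Uv; set q := [~ c, v]^-1.
  have -> : [~ c, v] = q^-1 by rewrite invgK.
  rewrite commVgJ.
  apply: memJ_class_support; last by rewrite invgK groupR // GH.
  apply: VY; apply: (@commg_class_maximal _ H2 Z p q) => //.
  - move=> z Zz; split; first exact: (subsetP sZ).
    have /andP[/commgP e _] := hU z v Zz Uv.
    by apply/commute_sym/commuteV/commute_sym.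
  - have -> : q * p = [~ c, u0 * v^-1] ^ v.
      have e2 : [~ c, u0 * v^-1] ^ v = (c ^ v)^-1 * c ^ u0.
        by rewrite commgEl conjMg conjVg -[(c ^ _) ^ v]conjgM mulgKV.
      by rewrite e2 /q /p [[~ c, v]]commgEl [[~ c, u0]]commgEl invMg invgK -mulgA mulKVg.
    rewrite card_classJ; first by apply: max0; rewrite groupM ?groupV.
    by rewrite (subsetP (normal_norm nH2)) ?GH.
have [|a b|E [M [[nE _] cE nM iM hM]]] := @class_support_commutators gT G H2 [set [~ c, v] | v in U'] Y (n * n) (n * n) _ nH2 sY cY cYk.
- by apply/subsetP=> _ /imsetP[v Uv ->]; rewrite groupR // GH // (subsetP sU'H).
- by case/imsetP=> v Uv -> Hb; apply: key => //; apply: (subsetP sU').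
exists E, (H2 :&: (U' :&: M))%G; split=> //.
- by rewrite (leq_trans cE) ?leq_addl.
- by apply: normalI => //; apply: normalI.
- rewrite (leq_trans (leq_index_setI _ _ _)) // (leq_trans _ (leq_addr _ _)) // leq_mul //.
  by rewrite (leq_trans (leq_index_setI _ _ _)) // leq_mul.
move=> v z /setIP[_ /setIP[Uv _]] /setIP[Hz /setIP[_ Mz]].
by apply: hM => //; apply: imset_f.
Qed.

(** * Classes and indices in quotients *)

Lemma mem_coset_quotient (gT : finGroupType) (E K : {group gT}) x :
  E \subset K -> x \in 'N(E) -> coset E x \in K / E -> x \in K.
Proof.
move=> sEK nx /morphimP[y ny Ky /(rcoset_kercosetP nx ny)/rcosetP[e Ee ->]].
by rewrite groupM // (subsetP sEK).
Qed.

Lemma card_class_quotient (gT : finGroupType) (E G : {group gT}) g :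
  E <| G -> g \in G -> #|coset E g ^: (G / E)| <= #|g ^: G|.
Proof.
move=> nE Gg; have nG := normal_norm nE.
by rewrite quotientE -morphim_class ?(subsetP nG) // leq_morphim.
Qed.

Lemma leq_index_quotient (gT : finGroupType) (E G K : {group gT}) :
  E <| G -> K \subset G -> #|G / E : K / E| <= #|G : K|.
Proof.
move=> nE sK; rewrite dvdn_leq ?indexg_gt0 // index_quotient //.
exact: subset_trans (subsetIl _ _) (normal_norm nE).
Qed.

(** First [E1] is divided out, after which [[~ c, s]] commutes with the part of [L] in a subgroup of
    bounded index. Each [u] has [[~ u, z]] in [L] for many [z], as these commutators have small
    class, so the central case applies to the quotient. *)
Lemma fixed_left_bounded n : exists N, forall (gT : finGroupType) (G : {group gT}) c,
    commutators_often_small G n -> c \in G ->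
  exists E K : {group gT}, [/\ E <| G, #|E| <= N, K <| G, #|G : K| <= N &
    forall v z, v \in K -> z \in K -> [~ c, v, z] \in E].
Proof.
have [N1 hN1] := fixed_left_small_class n.
have [N2 hN2] := fixed_left_central (n + N1)%N.
exists (N1 * N2 + N2)%N => gT G c hG Gc.
have [E1 [M [[nE1 sE1] cE1 nM iM [hM1 hM2]]]] := hN1 gT G c hG Gc.
have nGE := normal_norm nE1.
have nG x : x \in G -> x \in 'N(E1) by apply/subsetP.
have sMG := normal_sub nM.
pose L := <<small_class G n>>%G.
have nL : L <| G := small_class_gen_normal G n; have sLG := normal_sub nL.
have [|||||||Eb [Kb [nEb cEb nKb iKb hK]]] := hN2 _ (G / E1)%G (M / E1)%G (L / E1)%G (coset E1 c).
- exact: quotient_normal.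
- exact: quotient_normal.
- exact: mem_quotient.
- by rewrite (leq_trans (leq_index_quotient nE1 sMG)) // (leq_trans iM) ?leq_addl.
- move=> _ /morphimP[s ns Ms ->]; have Gs := subsetP sMG s Ms; rewrite -morphR ?nG //.
  rewrite (leq_trans (card_class_quotient _ _)) //; first exact: groupR.
  by rewrite (leq_trans (hM1 s Ms)) ?leq_addr.
- move=> _ _ /morphimP[s ns Ms ->] /morphimP[z nz Mz ->] Lz.
  have Lz' : z \in L by apply: mem_coset_quotient Lz.
  have Gs := subsetP sMG s Ms; have Gz := subsetP sMG z Mz.
  rewrite -!morphR ?nG ?groupR //.
  by apply: coset_id; apply: hM2.
- move=> _ /morphimP[u nu Gu ->]; have [S iS hS] := hG u Gu.
  exists ((G :&: S) / E1)%G.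
    rewrite (leq_trans (leq_index_quotient nE1 (subsetIl _ _))) // indexgI.
    by rewrite (leq_trans iS) ?leq_addr.
  move=> _ _ /morphimP[z nz /setIP[Gz Sz] ->]; rewrite -morphR ?nG //.
  apply: mem_quotient; apply: mem_gen; rewrite inE groupR //=; exact: hS.
have [E eE sE nE] := inv_quotientN nE1 nEb.
have [K eK sK nK] := inv_quotientN nE1 nKb.
exists E, K; split=> //.
- rewrite -(Lagrange sE) -card_quotient; last exact: subset_trans (normal_sub nE) nGE.
  by rewrite (leq_trans _ (leq_addr _ _)) // leq_mul // -eE.
- rewrite -(index_quotient_eq (H := E1)) ?(normal_sub nK) //; last by rewrite subIset ?sK ?orbT.
  by rewrite -eK (leq_trans iKb) ?leq_addl.
move=> v z Kv Kz; have Gv := subsetP (normal_sub nK) v Kv; have Gz := subsetP (normal_sub nK) z Kz.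
apply: mem_coset_quotient sE _ _; first by rewrite nG ?groupR.
have -> : coset E1 [~ c, v, z] = [~ coset E1 c, coset E1 v, coset E1 z].
  by rewrite !morphR ?nG ?groupR.
by rewrite -eE; apply: hK; rewrite eK mem_quotient.
Qed.

(** * From commuting triples to small classes *)

Lemma card_set_pairs (T T' : finType) (A : {set T}) (B : {set T'}) (R : T -> T' -> bool) :
  #|[set p | [&& p.1 \in A, p.2 \in B & R p.1 p.2]]| = \sum_(x in A) #|[set y in B | R x y]|.
Proof.
rewrite -sum1_card (eq_bigl (fun p => (p.1 \in A) && ((p.2 \in B) && R p.1 p.2))); last first.
  by move=> p; rewrite inE.
rewrite -(pair_big_dep (fun x => x \in A) (fun x y => (y \in B) && R x y) (fun _ _ => 1%N)) /=.
apply: eq_bigr => x _; rewrite -sum1_card; apply: eq_bigl => y.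
by rewrite inE.
Qed.

Lemma class_commg_submultiplicative (gT : finGroupType) (G : {group gT}) :
  submultiplicative G G (fun x y => #|[~ x, y] ^: G|).
Proof.
have nG x : x \in G -> x \in 'N(G) by apply/subsetP/normG.
split.
- move=> c c' w Gc Gc' Gw; rewrite commMgJ (leq_trans (card_classM _ _ _)) //.
  by rewrite card_classJ ?nG.
- move=> c w w' Gc Gw Gw'; rewrite commgMJ (leq_trans (card_classM _ _ _)) // mulnC.
  by rewrite card_classJ ?nG.
- by move=> c w Gc Gw; rewrite commVgJ card_classJ ?card_classV ?nG ?groupV.
- move=> c w Gc Gw; rewrite -invg_comm commVgJ card_classV card_classJ ?nG ?groupV //.
  by rewrite card_classV -invg_comm card_classV.
- by move=> w _; rewrite comm1g class1G cards1.
- by move=> c _; rewrite commg1 class1G cards1.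
Qed.

(** The triples over a pair are counted by the centralizer of [[~ x, y]], whose index is the class
    size. By averaging, many pairs have class size at most [2 * a]. *)
Lemma commuting_triples_often_small a : exists N, forall (gT : finGroupType) (G : {group gT}),
    #|G| ^ 3 <= a * #|[set t : gT * gT * gT |
      [&& t.1.1 \in G, t.1.2 \in G, t.2 \in G & [~ t.1.1, t.1.2, t.2] == 1]]| ->
  exists2 H : {group gT}, H \subset G /\ #|G : H| <= N & commutators_often_small H N.
Proof.
have [N hN] := submultiplicative_core (2 * a)%N; exists N => gT G h.
pose f (p : gT * gT) := #|[set z in G | [~ p.1, p.2, z] == 1]|.
have G0 : 0 < #|G| := cardG_gt0 G.
have e : #|[set t : gT * gT * gT |
      [&& t.1.1 \in G, t.1.2 \in G, t.2 \in G & [~ t.1.1, t.1.2, t.2] == 1]]|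
   = \sum_(p in setX G G) f p.
  rewrite -(card_set_pairs _ _ (fun p z => [~ p.1, p.2, z] == 1)).
  by apply: eq_card => t; rewrite !inE -!andbA.
rewrite e in h.
have hm : #|setX G G| <= (2 * a) * #|[set p in setX G G | #|G| <= (2 * a) * f p]|.
  apply: markov_card => //.
    by move=> p _; apply: subset_leq_card; apply/subsetP=> z; rewrite inE => /andP[].
  by rewrite cardsX mulnn -expnSr.
have [|H [sH iH] hH] := hN gT G _ (class_commg_submultiplicative G).
  rewrite cardsX mulnn in hm; apply: leq_trans hm _; rewrite leq_mul //.
  rewrite -(card_set_pairs _ _ (fun c w => #|[~ c, w] ^: G| <= 2 * a)).
  apply: subset_leq_card; apply/subsetP=> -[x y]; rewrite !inE /= -andbA => /and3P[-> -> /=].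
  have -> : f (x, y) = #|'C_G[[~ x, y]]|.
    apply: eq_card => z; rewrite [LHS]inE [RHS]in_setI; congr (_ && _).
    by apply/commgP/cent1P => /commute_sym.
  by rewrite -index_cent1 -(Lagrange (subsetIl G 'C[[~ x, y]])) mulnC leq_pmul2r.
exists H => // x Hx; have [T [sT iT] hT] := hH x Hx; exists T.
  by rewrite (leq_trans (leq_indexSl _ sH)).
move=> s Hs Ts; rewrite (leq_trans (card_class_subl _ sH)) //.
by rewrite -invg_comm card_classV hT.
Qed.

(** With [c0] generic, [[~ x, u]] is expanded through [[~ x * c0, u]], with [u] compared to some [w]
    in [W] and to a coset representative [t]. All factors have small class except [[~ c0, w]] and
    [[~ c0, t]^-1], which take boundedly many values. *)
Lemma often_small_finite_cover n : exists N, forall (gT : finGroupType) (G : {group gT}),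
    commutators_often_small G n ->
  exists (V : {group gT}) (C : {set gT}),
    [/\ V \subset G /\ #|G : V| <= N, commutators_often_small V N, C \subset V, #|C| <= N &
      forall x y, x \in V -> y \in V -> exists2 c, c \in C & #|(c^-1 * [~ x, y]) ^: V| <= N].
Proof.
have [N1 hN1] := generic_point n.
pose M := (n * (N1 * n))%N.
exists (N1 + n + (n * n).+1 + M * M)%N => gT G hG.
have sm := class_commg_submultiplicative G.
have nG x : x \in G -> x \in 'N(G) by apply/subsetP/normG.
have [||c0 [W [V [Gc0 [sW cW] [sV iV] hVW hV]]]] := hN1 gT G G _ sm.
- by move=> c Gc; apply: hG.
- move=> w Gw; have [S iS hS] := hG w Gw; exists S => // c Gc Sc.
  by rewrite -invg_comm card_classV hS.
have [S iS hS] := hG c0 Gc0.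
have [T [sT cT] hT] := exists_coset_reps G S.
have GV x : x \in V -> x \in G by apply/subsetP.
pose C' := [set ([~ c0, w] * [~ c0, t]^-1) ^ c0^-1 | w in W, t in T].
have cC' : #|C'| <= n * n.
  rewrite /C' curry_imset2X (leq_trans (leq_imset_card _ _)) // cardsX leq_mul //.
  by rewrite cT.
have hC' x u : x \in V -> u \in V -> exists2 c, c \in C' & #|(c^-1 * [~ x, u]) ^: G| <= M.
  move=> Vx Vu; have [Gx Gu] := (GV x Vx, GV u Vu).
  have [w Ww hw] := hV x u Vx Gu; have Gw := subsetP sW w Ww.
  have [t Tt St] := hT u Gu; have Gt := subsetP sT t Tt.
  exists (([~ c0, w] * [~ c0, t]^-1) ^ c0^-1); first exact: imset2_f.
  set f1 := [~ x, w] ^ c0; set f2 := [~ x * c0, u * w^-1] ^ w.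
  set f3 := ([~ c0, u * t^-1] ^ t)^-1; set e := [~ c0, w]; set e' := [~ c0, t].
  have e1 : [~ x * c0, u] = f1 * e * f2.
    by rewrite -{1}[u](mulgKV w) commgMJ commMgJ.
  have e2 : [~ c0, u] = e' * f3^-1 by rewrite invgK -{1}[u](mulgKV t) commgMJ.
  have e3 : [~ x, u] ^ c0 = f1 * e * f2 * (f3 * e'^-1).
    rewrite -e1 (_ : f3 * e'^-1 = [~ c0, u]^-1); last by rewrite e2 [RHS]invMg invgK.
    by rewrite [[~ x * c0, u]]commMgJ mulgK.
  have e4 : ((e * e'^-1) ^ c0^-1)^-1 * [~ x, u] = (f1 ^ e * (f2 * f3)) ^ (e'^-1 * c0^-1).
    rewrite -[[~ x, u]](conjgK c0) e3 -conjVg -conjMg [RHS]conjgM; congr (_ ^ _).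
    by rewrite !conjgE invMg !invgK !mulgA mulgK.
  rewrite e4 card_classJ; last by rewrite nG ?groupM ?groupV ?groupR.
  apply: leq_trans (card_classM _ _ _) _; apply: leq_mul.
    by rewrite !card_classJ ?nG ?groupR ?hVW.
  apply: leq_trans (card_classM _ _ _) _; apply: leq_mul.
    by rewrite card_classJ ?nG.
  by rewrite card_classV card_classJ ?nG //; apply: hS => //; rewrite groupM ?groupV.
(* [C'] need not lie in [V], so its members are replaced by commutators of [V]. Two commutators near
   the same [c] differ by an element of class at most [M * M]. *)
pose g (p : gT * gT) := [pick c in C' | #|(c^-1 * [~ p.1, p.2]) ^: G| <= M].
have [R [sR cR] hR] := exists_reps g (setX V V).
have RV p : p \in R -> p.1 \in V /\ p.2 \in V.
  by move/(subsetP sR); rewrite inE => /andP.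
exists V, [set [~ p.1, p.2] | p in R]; split.
- split=> //; rewrite (leq_trans iV) // -!addnA leq_addr //.
- move=> x Vx; have [U iU hU] := hG x (GV x Vx); exists U.
    by rewrite (leq_trans (leq_indexSl _ sV)) // (leq_trans iU) // addnAC; lia.
  move=> s Vs Us; rewrite (leq_trans (card_class_subl _ sV)) //.
  by rewrite (leq_trans (hU s (GV s Vs) Us)) //; lia.
- by apply/subsetP=> _ /imsetP[p /RV[V1 V2] ->]; rewrite groupR.
- rewrite (leq_trans (leq_imset_card _ _)) // cR.
  have : #|g @: setX V V| <= #|None |: Some @: C'|.
    apply: subset_leq_card; apply/subsetP=> _ /imsetP[p _ ->]; rewrite !inE /g.
    by case: pickP => //= c /andP[Cc _]; rewrite imset_f.
  rewrite cardsU1 => /leq_trans; apply.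
  apply: leq_trans (leq_add (leq_b1 _) (leq_trans (leq_imset_card _ _) cC')) _.
  by rewrite add1n (leq_trans _ (leq_addr _ _)) // leq_addl.
move=> x y Vx Vy; have [[x' y'] Rp e] := hR (x, y) (introT setXP (conj Vx Vy)).
have [/= Vx' Vy'] := RV _ Rp.
exists [~ x', y']; first by apply/imsetP; exists (x', y').
rewrite (leq_trans (card_class_subl _ sV)) //.
apply: (@leq_trans (M * M)); last by lia.
move: e; rewrite /g; case: pickP => [c /andP[Cc h1]|no]; last first.
  by have [c Cc hc] := hC' x' y' Vx' Vy'; have := no c; rewrite /= Cc hc.
case: pickP => // c' /andP[Cc' h2] [ec]; rewrite -ec in h2.
have -> : [~ x', y']^-1 * [~ x, y] = (c^-1 * [~ x', y'])^-1 * (c^-1 * [~ x, y]).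
  by rewrite [(c^-1 * [~ x', y'])^-1]invMg invgK -mulgA mulKVg.
by apply: leq_trans (card_classM _ _ _) _; rewrite card_classV leq_mul.
Qed.

(** * Conclusion *)

Lemma fixed_left_bounded_set n m : exists N, forall (gT : finGroupType) (G : {group gT}) (C : {set gT}),
    commutators_often_small G n -> C \subset G -> #|C| <= m ->
  exists E K : {group gT}, [/\ E <| G, K <| G, #|G : K| <= N, #|E| <= N &
    forall c v z, c \in C -> v \in K -> z \in K -> [~ c, v, z] \in E].
Proof.
have [N hN] := fixed_left_bounded n; exists (N.+1 ^ m)%N => gT G C hG sC cC.
suff [E [K [nE nK iK cE hK]]] : exists E K : {group gT},
    [/\ E <| G, K <| G, #|G : K| <= N.+1 ^ size (enum C), #|E| <= N.+1 ^ size (enum C) &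
    forall c v z, c \in enum C -> v \in K -> z \in K -> [~ c, v, z] \in E].
  have le : N.+1 ^ size (enum C) <= N.+1 ^ m by rewrite leq_pexp2l // -cardE.
  exists E, K; split=> //; rewrite ?(leq_trans iK) ?(leq_trans cE) //.
  by move=> c v z Cc; apply: hK; rewrite mem_enum.
have: {subset enum C <= G} by move=> c; rewrite mem_enum; apply/subsetP.
elim: (enum C) => [|c s IHs] sG.
  exists 1%G, G; split; rewrite ?normal1 ?normal_refl ?indexgg ?cards1 //.
have [|E1 [K1 [nE1 nK1 iK1 cE1 hK1]]] := IHs; first by move=> x sx; apply: sG; rewrite inE sx orbT.
have [E2 [K2 [nE2 cE2 nK2 iK2 hK2]]] := hN gT G c hG (sG c (mem_head _ _)).
exists (E2 <*> E1)%G, (K2 :&: K1)%G; split.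
- exact: normalY.
- exact: normalI.
- rewrite (leq_trans (leq_index_setI _ _ _)) //= expnS leq_mul //; exact: leqW.
- rewrite /= norm_joinEl; last exact: subset_trans (normal_sub nE2) (normal_norm nE1).
  rewrite (leq_trans (card_mulg_le _ _)) // expnS leq_mul //; exact: leqW.
move=> x v z; rewrite inE => /predU1P[-> | sx] /setIP[v2 v1] /setIP[z2 z1].
  by apply: (subsetP (joing_subl _ _)); apply: hK2.
by apply: (subsetP (joing_subr _ _)); apply: hK1.
Qed.

(** Write [[~ x, y] = c * f]. For [z] centralising [f] only [[~ c, z] ^ f] remains, which is central
    in [K]. Conjugation by [c] multiplies elements of [K] by central ones, so it fixes their
    commutators and [c] centralises the derived subgroup. *)
Lemma small_commutators_cover (gT : finGroupType) (G K : {group gT}) (C : {set gT}) k :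
    K <| G -> C \subset G ->
    (forall c v z, c \in C -> v \in K -> z \in K -> [~ c, v, z] = 1) ->
    (forall x y, x \in K -> y \in K ->
       exists2 c, c \in C & #|(c^-1 * [~ x, y]) ^: G| <= k) ->
  small_commutators K k.
Proof.
move=> nK sC hC cover x y Kx Ky; have [c Cc cf] := cover x y Kx Ky.
have Gc := subsetP sC c Cc; have sKG := normal_sub nK.
have GK z : z \in K -> z \in G by apply/subsetP.
set f := c^-1 * _ in cf.
have Gf : f \in G by rewrite groupM ?groupV // groupR ?GK.
have ef : [~ x, y] = c * f by rewrite mulKVg.
have Zc z : z \in K -> [~ c, z] \in 'Z(K).
  move=> Kz; apply/setIP; split.
    by rewrite commgEr groupM // memJ_norm ?groupV // (subsetP (normal_norm nK)).
  by apply/centP=> w Kw; apply/commgP/eqP; apply: hC.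
exists 'C_G[f]%G.
  by rewrite (leq_trans (leq_indexSl _ sKG)) // index_cent1.
move=> z Kz /setIP[_ /cent1P cz].
have -> : [~ x, y, z] = [~ c, z] ^ f.
  by rewrite ef commMgJ (eqP (introT commgP (commute_sym cz))) mulg1.
split.
  rewrite memJ_norm ?Zc // (subsetP _ f Gf) //.
  exact: normal_norm (char_normal_trans (center_char K) nK).
move=> Lz; suff -> : [~ c, z] = 1 by rewrite conj1g.
suff sL : [~: K, K] \subset 'C[c].
  by apply/eqP/commgP/commute_sym/cent1P/(subsetP sL); rewrite -derg1.
rewrite gen_subG; apply/subsetP=> _ /imset2P[u v Ku Kv ->].
have Zc' w : w \in K -> w ^ c = w * [~ c, w]^-1 by move=> Kw; rewrite invg_comm conjg_mulR.
have ZJ w t : w \in K -> t \in 'Z(K) -> w ^ t = w.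
  by move=> Kw /setIP[_ /centP ct]; apply/conjg_fixP/commgP/commute_sym/ct.
have ZC w t : w \in K -> t \in 'Z(K) -> [~ t, w] = 1.
  by move=> Kw /setIP[_ /centP ct]; apply/eqP/commgP/ct.
have ZV w : w \in K -> [~ c, w]^-1 \in 'Z(K) by move=> Kw; rewrite groupV Zc.
have ZK t : t \in 'Z(K) -> t \in K by case/setIP.
apply/cent1P/commgP/conjg_fixP; rewrite conjRg !Zc' //.
have := ZV u Ku; have := ZV v Kv.
move: ([~ c, v]^-1) ([~ c, u]^-1) => s t Zs Zt.
have Kvs : v * s \in K by apply: groupM; last exact: ZK.
rewrite [LHS]commMgJ (ZC _ _ Kvs Zt) mulg1 (ZJ _ _ _ Zt) ?groupR //.
have us : [~ u, s] = 1 by rewrite -invg_comm (ZC _ _ Ku Zs) invg1.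
by rewrite commgMJ us mul1g (ZJ _ _ _ Zs) ?groupR.
Qed.

(** * Passage to subgroups and quotients *)

Lemma small_commutators_sub (gT : finGroupType) (H K : {group gT}) k :
  K \subset H -> small_commutators H k -> small_commutators K k.
Proof.
move=> sKH hH x y Kx Ky.
have [U iU hU] := hH x y (subsetP sKH x Kx) (subsetP sKH y Ky).
exists U; first by rewrite (leq_trans (leq_indexSl _ sKH)).
move=> z Kz Uz; have [/setIP[_ cz] h] := hU z (subsetP sKH z Kz) Uz; split.
  by apply/setIP; split; [rewrite !groupR | apply: (subsetP (centS sKH))].
by move=> Lz; apply: h; apply: (subsetP (dergS 1 sKH)).
Qed.

(** Since [E] lies in [H^](1)[, an element of]H[whose image is in the derived subgroup of]H /
    E[is itself in]H^[(1)]. *)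
Lemma small_commutators_quotient (gT : finGroupType) (E H : {group gT}) k :
  E <| H -> E \subset H^`(1) -> small_commutators H k -> small_commutators (H / E) k.
Proof.
move=> nE sE hH _ _ /morphimP[x nx Hx ->] /morphimP[y ny Hy ->].
have [U iU hU] := hH x y Hx Hy.
have nH z : z \in H -> z \in 'N(E) by apply/subsetP/normal_norm.
exists ((H :&: U) / E)%G.
  by rewrite (leq_trans (leq_index_quotient nE (subsetIl _ _))) // indexgI.
move=> _ _ /morphimP[z nz /setIP[Hz Uz] ->].
have e : [~ coset E x, coset E y, coset E z] = coset E [~ x, y, z].
  by rewrite !morphR ?groupR.
have [/setIP[Hxyz /centP cz] h] := hU z Hz Uz.
rewrite e; split.
  apply/setIP; split; first exact: mem_quotient.
  apply/centP=> _ /morphimP[w nw Hw ->].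
  by rewrite /commute -!morphM ?nH //; congr (coset E _); apply: cz.
rewrite -quotient_der ?normal_norm // => Lz; apply/coset_id.
by rewrite h ?group1 //; apply: mem_coset_quotient Lz.
Qed.

Definition lcn4_bounded (gT : finGroupType) (G : {group gT}) M :=
  exists2 H : {group gT}, H \subset G /\ #|G : H| <= M & #|'L_4(H)| <= M.

Lemma lcn4_bounded_sub (gT : finGroupType) (G H : {group gT}) N M :
  H \subset G -> #|G : H| <= N -> lcn4_bounded H M -> lcn4_bounded G (N * M).
Proof.
move=> sHG iH [K [sK iK] cK]; have N0 := leq_trans (indexg_gt0 G H) iH.
exists K; first split; first exact: subset_trans sK sHG.
  by rewrite (leq_trans (leq_index_trans _ sHG)) ?leq_mul.
by rewrite (leq_trans cK) ?leq_pmull.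
Qed.

Lemma lcn4_bounded_quotient (gT : finGroupType) (E G : {group gT}) N M :
  E <| G -> #|E| <= N -> lcn4_bounded (G / E) M -> lcn4_bounded G (N * M).
Proof.
move=> nE cE [Kb [sKb iKb] cKb]; have N0 := leq_trans (cardG_gt0 E) cE.
have [K eK sEK sKG] := inv_quotientS nE sKb.
have nG := normal_norm nE; have nK := subset_trans sKG nG.
exists K; first split=> //.
  rewrite -(index_quotient_eq (H := E)) ?subIset ?sEK ?orbT //.
  by rewrite -eK (leq_trans iKb) ?leq_pmull.
have nL : 'L_4(K) \subset 'N(E) by apply: subset_trans (lcn_sub 4 K) nK.
have cL : #|'L_4(K) / E| <= M by rewrite quotientE morphim_lcn // -quotientE -eK.
rewrite -(LagrangeI 'L_4(K) E) leq_mul //.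
  by rewrite (leq_trans (subset_leq_card (subsetIr _ _))).
by rewrite -card_quotient.
Qed.

(** In the centralizer of ['L_4(K)], of index at most [M ^ M] in [K], the fourth term becomes
    central and the fifth trivial. *)
Lemma lcn4_bounded_class (gT : finGroupType) (G : {group gT}) M : lcn4_bounded G M ->
  exists H : {group gT}, [/\ H \subset G, nilpotent H, nil_class H <= 4,
    #|G : H| <= M * M ^ M & #|'L_4(H)| <= M].
Proof.
case=> K [sK iK] cK; have nL : 'L_4(K) <| K := lcn_normal 4 K.
have [nH iH _] := commutators_bounded (normal_sub nL) (normal_norm nL) cK.
set H := ('C_K('L_4(K)))%G in nH iH.
have sHK := normal_sub nH.
have s4 : 'L_4(H) \subset 'L_4(K) := lcnS 4 sHK.
have L5 : 'L_5(H) = 1.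
  rewrite lcnSn; apply/commG1P; apply: subset_trans s4 _.
  by rewrite centsC subsetIr.
have nilH : nilpotent H by apply/lcnP; exists 4.
exists H; split=> //.
- exact: subset_trans sHK sK.
- exact/lcn_nil_classP.
- by rewrite (leq_trans (leq_index_trans _ sK)) ?leq_mul.
- exact: leq_trans (subset_leq_card s4) cK.
Qed.

Lemma commuting_triples_lcn4_bounded a : exists M, forall (gT : finGroupType) (G : {group gT}),
    #|G| ^ 3 <= a * #|[set t : gT * gT * gT |
      [&& t.1.1 \in G, t.1.2 \in G, t.2 \in G & [~ t.1.1, t.1.2, t.2] == 1]]| ->
  lcn4_bounded G M.
Proof.
have [N1 hN1] := commuting_triples_often_small a.
have [N2 hN2] := often_small_finite_cover N1.
have [N3 hN3] := fixed_left_bounded_set N2 N2.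
have [N4 hN4] := derived2_bounded N2.
have [N5 hN5] := lcn4_bounded_metabelian N2.
(* One factor for each reduction, in order: the subgroups [H1] and [H2], the quotient by [E], the
   subgroup [K / E], the subgroup [H3], the quotient by [E'], and the metabelian case. *)
exists (N1 * (N2 * (N3 * (N3 * (N4 * (N4 * N5))))))%N => gT G hG.
have [H1 [s1 i1] h1] := hN1 gT G hG; apply: (lcn4_bounded_sub s1 i1 _).
have [H2 [C [[s2 i2] h2 sC cC cover]]] := hN2 gT H1 h1; apply: (lcn4_bounded_sub s2 i2 _).
have [E [K [nE nK iK cE hK]]] := hN3 gT H2 C h2 sC cC.
apply: (lcn4_bounded_quotient nE cE _).
have sK := normal_sub nK; have nG := normal_norm nE.
have iK' := leq_trans (leq_index_quotient nE sK) iK.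
apply: (lcn4_bounded_sub (quotientS E sK) iK' _).
have smK : small_commutators (K / E) N2.
  apply: (@small_commutators_cover _ (H2 / E)%G (K / E)%G (coset E @: C)).
  - exact: quotient_normal.
  - by apply/subsetP=> _ /imsetP[c Cc ->]; apply/mem_quotient/(subsetP sC).
  - move=> _ _ _ /imsetP[c Cc ->] /morphimP[v nv Kv ->] /morphimP[z nz Kz ->].
    have nc : c \in 'N(E) := subsetP nG c (subsetP sC c Cc).
    by rewrite -!morphR ?groupR //; apply/coset_id/hK.
  - move=> _ _ /morphimP[x nx Kx ->] /morphimP[y ny Ky ->].
    have [c Cc cf] := cover x y (subsetP sK x Kx) (subsetP sK y Ky).
    have Hc := subsetP sC c Cc; have nc : c \in 'N(E) := subsetP nG c Hc.
    exists (coset E c); first exact: imset_f.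
    rewrite -morphR // -morphV // -morphM ?groupV ?groupR //.
    rewrite (leq_trans (card_class_quotient nE _)) // groupM ?groupV ?groupR //.
      exact: (subsetP sK).
    exact: (subsetP sK).
have [H3 [E' [s3 i3 [nE' sE'] cE' d3]]] := hN4 _ (K / E)%G smK.
apply: (lcn4_bounded_sub s3 i3 _); apply: (lcn4_bounded_quotient nE' cE' _).
have := hN5 _ (H3 / E')%G; case=> //.
- have e : (H3 / E')^`(2) = 1.
    rewrite -quotient_der ?normal_norm //; apply/trivgP.
    by rewrite quotient_sub1 // (subset_trans (der_sub 2 H3)) // normal_norm.
  by apply/commG1P; rewrite -dergSn.
- apply: (small_commutators_quotient nE' sE' _); exact: (small_commutators_sub s3 smK).
- by move=> M [sM iM] cM; exists M.
Qed.

Local Open Scope ring_scope.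
Import Order.TTheory GRing.Theory Num.Theory.

Theorem theorem1p1 (R : realType) (eps : R) (heps : 0 < eps) :
  exists M : nat,
    forall (gT : finGroupType) (G : {group gT}),
      eps <= d2 R G ->
      exists H : {group gT},
        [/\ H \subset G,
            nilpotent H,
            (nil_class H <= 4)%N,
            (#|G : H|%g <= M)%N &
            (#|'L_4(H)%g| <= M)%N].
Proof.
(* An integer above [eps^-1], so that [eps <= d2 R G] becomes an inequality between natural
   numbers. *)
pose a := (Num.truncn eps^-1).+1.
have [M hM] := commuting_triples_lcn4_bounded a.
exists (M * M ^ M + M)%N => gT G hd.
have [|H [h1 h2 h3 h4 h5]] := lcn4_bounded_class (hM gT G _).
  have G0 : 0 < (#|G|%:R ^+ 3 : R) by rewrite exprn_gt0 // ltr0n cardG_gt0.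
  move: hd; rewrite /d2 ler_pdivlMr // => hd.
  have ha : 1 <= a%:R * eps.
    by rewrite -ler_pdivrMr // mul1r ltW // truncnS_gt.
  rewrite -(ler_nat R) natrX natrM.
  apply: le_trans (_ : a%:R * (eps * #|G|%:R ^+ 3) <= _); last by rewrite ler_wpM2l.
  by rewrite mulrA ler_peMl // ltW.
exists H; split=> //; first exact: leq_trans h4 (leq_addr _ _).
exact: leq_trans h5 (leq_addl _ _).
Qed.
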